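(* Let $(M^{2n+1},\varphi,\xi,\eta,g)$ be a trans-para-Sasakian manifold of type $(\alpha,\beta)$ such that $\varphi(\mathrm{grad}\,\alpha)=-(2n-1)\,\mathrm{grad}\,\beta$. If the PC-Bochner curvature tensor $\mathbf{B}$ satisfies $\mathbf{B}(\xi,Y)\mathrm{Ric}=0$ for all vector fields $Y$, then either $M$ is an Einstein manifold with scalar curvature $\mathrm{scal}=-2n(2n+1)(\alpha^2+\beta^2)$, or $\alpha^2+\beta^2=1$.
   Context: Let $n\ge 1$ and let $M$ be a smooth manifold of dimension $2n+1$. An almost paracontact metric structure $(\varphi,\xi,\eta,g)$ on $M$ consists of a $(1,1)$-tensor field $\varphi$, a vector field $\xi$, a 1-form $\eta$ and a pseudo-Riemannian metric $g$ with $\varphi\xi=0$, $\eta\circ\varphi=0$, $\eta(\xi)=1$, $\varphi^2=\mathrm{id}-\eta\otimes\xi$, $g(\varphi X,\varphi Y)=-g(X,Y)+\eta(X)\eta(Y)$, such that $\varphi$ induces an almost paracomplex structure on $\ker\eta$ (its $\pm1$-eigendistributions there have equal rank $n$). Then $\eta(X)=g(X,\xi)$ and $g$ has signature $(n+1,n)$. Let $\nabla$ be the Levi-Civita connection of $g$. The manifold is called trans-para-Sasakian of type $(\alpha,\beta)$, where $\alpha,\beta$ are smooth functions on $M$, if for all vector fields $X,Y$ $$(\nabla_X\varphi)Y=\alpha(-g(X,Y)\xi+\eta(Y)X)+\beta(g(X,\varphi Y)\xi+\eta(Y)\varphi X).$$ Curvature: $R(X,Y)Z=\nabla_X\nabla_YZ-\nabla_Y\nabla_XZ-\nabla_{[X,Y]}Z$,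 $R(X,Y,Z,W)=g(R(X,Y)Z,W)$; $\mathrm{Ric}(Y,Z)$ is the trace of $X\mapsto R(X,Y)Z$; $\mathrm{scal}$ is the $g$-trace of $\mathrm{Ric}$; gradients are taken with respect to $g$. The PC-Bochner curvature tensor is $$\begin{aligned}\mathbf{B}(X,Y,Z,W)={}&R(X,Y,Z,W)+\tfrac{1}{2n+4}\big(\mathrm{Ric}(X,Z)g(Y,W)-\mathrm{Ric}(Y,Z)g(X,W)\\&+\mathrm{Ric}(Y,W)g(X,Z)-\mathrm{Ric}(X,W)g(Y,Z)+\mathrm{Ric}(\varphi X,Z)g(Y,\varphi W)\\&-\mathrm{Ric}(\varphi Y,Z)g(X,\varphi W)+\mathrm{Ric}(\varphi Y,W)g(X,\varphi Z)-\mathrm{Ric}(\varphi X,W)g(Y,\varphi Z)\\&+2\mathrm{Ric}(\varphi X,Y)g(Z,\varphi W)+2\mathrm{Ric}(\varphi Z,W)g(X,\varphi Y)-\mathrm{Ric}(X,Z)\eta(Y)\eta(W)\\&+\mathrm{Ric}(Y,Z)\eta(X)\eta(W)-\mathrm{Ric}(Y,W)\eta(X)\eta(Z)+\mathrm{Ric}(X,W)\eta(Y)\eta(Z)\big)\\&+\tfrac{k-4}{2n+4}\big(g(X,Z)g(Y,W)-g(Y,Z)g(X,W)\big)\\&-\tfrac{k+2n}{2n+4}\big(g(Y,\varphi W)g(X,\varphi Z)-g(X,\varphi W)g(Y,\varphi Z)+2g(X,\varphi Y)g(Z,\varphi W)\big)\\&-\tfrac{k}{2n+4}\big(g(X,Z)\eta(Y)\eta(W)-g(Y,Z)\eta(X)\eta(W)+g(Y,W)\eta(X)\eta(Z)-g(X,W)\eta(Y)\eta(Z)\big),\end{aligned}$$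 where $k=-\frac{\mathrm{scal}-2n}{2n+2}$; $\mathbf{B}(X,Y)Z$ is defined by $g(\mathbf{B}(X,Y)Z,W)=\mathbf{B}(X,Y,Z,W)$. $\mathbf{B}(\xi,Y)\mathrm{Ric}=0$ means $\mathrm{Ric}(\mathbf{B}(\xi,Y)Z,V)+\mathrm{Ric}(Z,\mathbf{B}(\xi,Y)V)=0$ for all vector fields $Z,V$. $M$ is Einstein if $\mathrm{Ric}=\lambda g$ for some function $\lambda$ (automatically locally constant since $\dim M\ge 3$).
   Formalization: The formal theorem additionally assumes that M is connected; without this the global either/or fails on a disjoint union of a non-Einstein manifold with α²+β²=1 and an Einstein one with α²+β²≠1. *)

(* Defs.v *)
From HB Require Import structures.
From mathcomp Require Import all_boot all_order all_algebra.
From mathcomp Require Import all_classical all_reals all_analysis.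
Import Order.TTheory GRing.Theory Num.Theory.
Import numFieldNormedType.Exports.

Set Implicit Arguments.
Unset Strict Implicit.
Unset Printing Implicit Defensive.

Local Open Scope classical_set_scope.
Local Open Scope ring_scope.

Section SmoothFunctions.
Context {R : realType} {d : nat}.

Definition unit_vec (i : 'I_d) : 'rV[R]_d := delta_mx 0 i.

Definition iter_partial (s : seq 'I_d) (f : 'rV[R]_d -> R) : 'rV[R]_d -> R :=
  foldr (fun i h => fun x => 'D_(unit_vec i) h x) f s.

(* f is C^oo on the open set U: iterated partial derivatives of every order
   exist and are differentiable at each point of U.  The values of f outside U
   are irrelevant. *)
Definition smooth_on (U : set 'rV[R]_d) (f : 'rV[R]_d -> R) : Prop :=
  forall s x, U x -> differentiable (iter_partial s f) x.

End SmoothFunctions.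

Record chart (R : realType) (d : nat) (T : topologicalType) := Chart {
  cdom : set T;
  cmap : T -> 'rV[R]_d;
  cinv : 'rV[R]_d -> T
}.

Definition cimage (R : realType) d T (c : chart R d T) : set 'rV[R]_d :=
  cmap c @` cdom c.

Record is_chart (R : realType) d T (c : chart R d T) : Prop := IsChart {
  cdom_open : open (cdom c);
  cimage_open : open (cimage c);
  cinvK : forall p, cdom c p -> cinv c (cmap c p) = p;
  cmap_continuous : {within cdom c, continuous (cmap c)};
  cinv_continuous : {within cimage c, continuous (cinv c)}
}.

Definition smooth_transition (R : realType) d T (c c' : chart R d T) : Prop :=
  forall j : 'I_d,
    smooth_on (cmap c @` (cdom c `&` cdom c'))
              (fun x => cmap c' (cinv c x) 0 j).

(* [chart_at p] is a chosen chart around p.  The tangent space T_pM is the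
   space of row vectors 'rV[R]_d, a tangent vector being represented by its
   components in [chart_at p]. *)
Record smoothManifold (R : realType) (d : nat) := SmoothManifold {
  mspace :> topologicalType;
  atlas : set (chart R d mspace);
  chart_at : mspace -> chart R d mspace;
  mspace_hausdorff : hausdorff_space mspace;
  mspace_second_countable : @second_countable mspace;
  atlas_is_chart : forall c, atlas c -> is_chart c;
  atlas_smooth : forall c c', atlas c -> atlas c' -> smooth_transition c c';
  chart_at_atlas : forall p, atlas (chart_at p);
  chart_at_dom : forall p, cdom (chart_at p) p
}.

Section VectorFields.
Context {R : realType} {d : nat} {M : smoothManifold R d}.
Implicit Types (c : chart R d M) (f : M -> R) (W : set M) (p : M).

(* A (not necessarily smooth) vector field, defined on all of M.  A vector
   field on an open set W is given by any extension of it. *)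
Definition vfield := M -> 'rV[R]_d.
Implicit Types (X Y Z : vfield).

(* Components in the chart c of the tangent vector v at p. *)
Definition components c p (v : 'rV[R]_d) : 'rV[R]_d :=
  'D_v (cmap c \o cinv (chart_at p)) (cmap (chart_at p) p).

Definition vfield_in c X : 'rV[R]_d -> 'rV[R]_d :=
  fun x => components c (cinv c x) (X (cinv c x)).

Definition smooth_fun W f : Prop :=
  forall c, atlas c ->
    smooth_on (cmap c @` (cdom c `&` W)) (f \o cinv c).

Definition smooth_vfield W X : Prop :=
  forall c, atlas c -> forall j : 'I_d,
    smooth_on (cmap c @` (cdom c `&` W)) (fun x => vfield_in c X x 0 j).

(* df_p(v) *)
Definition dfun f p (v : 'rV[R]_d) : R :=
  'D_v (f \o cinv (chart_at p)) (cmap (chart_at p) p).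

Definition bracket X Y : vfield := fun p =>
  let c := chart_at p in
  'D_(X p) (vfield_in c Y) (cmap c p) - 'D_(Y p) (vfield_in c X) (cmap c p).

(* The vector field on the domain of [chart_at p] whose components in that
   chart are constant, equal to v; its value at p is v. *)
Definition const_field p (v : 'rV[R]_d) : vfield := fun q =>
  'D_v (cmap (chart_at q) \o cinv (chart_at p)) (cmap (chart_at p) q).

(* [g p] is the Gram matrix of a bilinear form on T_pM. *)
Definition bil (g : M -> 'M[R]_d) p (u v : 'rV[R]_d) : R :=
  (u *m g p *m v^T) 0 0.

Definition pseudo_riemannian (g : M -> 'M[R]_d) : Prop :=
  [/\ forall p, (g p)^T = g p,
      forall p, g p \in unitmx
    & forall W X Y, open W -> smooth_vfield W X -> smooth_vfield W Y ->
        smooth_fun W (fun p => bil g p (X p) (Y p))].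

(* The Levi-Civita connection, as an operator acting on the vector fields of
   every open subset W of M, not only on the global ones. *)
Record levi_civita (g : M -> 'M[R]_d) (nabla : vfield -> vfield -> vfield)
  : Prop := LeviCivita {
  nabla_smooth : forall W X Y, open W ->
    smooth_vfield W X -> smooth_vfield W Y -> smooth_vfield W (nabla X Y);
  nablaDl : forall W X Y Z p, open W ->
    smooth_vfield W X -> smooth_vfield W Y -> smooth_vfield W Z -> W p ->
    nabla (fun q => X q + Y q) Z p = nabla X Z p + nabla Y Z p;
  nablaDr : forall W X Y Z p, open W ->
    smooth_vfield W X -> smooth_vfield W Y -> smooth_vfield W Z -> W p ->
    nabla X (fun q => Y q + Z q) p = nabla X Y p + nabla X Z p;
  nablaZl : forall W f X Y p, open W ->
    smooth_fun W f -> smooth_vfield W X -> smooth_vfield W Y -> W p ->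
    nabla (fun q => f q *: X q) Y p = f p *: nabla X Y p;
  nablaZr : forall W f X Y p, open W ->
    smooth_fun W f -> smooth_vfield W X -> smooth_vfield W Y -> W p ->
    nabla X (fun q => f q *: Y q) p =
      dfun f p (X p) *: Y p + f p *: nabla X Y p;
  nabla_torsion_free : forall W X Y p, open W ->
    smooth_vfield W X -> smooth_vfield W Y -> W p ->
    nabla X Y p - nabla Y X p = bracket X Y p;
  nabla_metric : forall W X Y Z p, open W ->
    smooth_vfield W X -> smooth_vfield W Y -> smooth_vfield W Z -> W p ->
    dfun (fun q => bil g q (Y q) (Z q)) p (X p) =
      bil g p (nabla X Y p) (Z p) + bil g p (Y p) (nabla X Z p)
}.

Section Tensors.
Variables (g : M -> 'M[R]_d) (nabla : vfield -> vfield -> vfield).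

(* The tangent vector w at p such that g(w, v) = l(v) for all v, for a linear
   form l on T_pM. *)
Definition sharp p (l : 'rV[R]_d -> R) : 'rV[R]_d :=
  (\row_i l (unit_vec i)) *m invmx (g p).

Definition grad f p : 'rV[R]_d := sharp p (dfun f p).

Definition curvature X Y Z : vfield := fun p =>
  nabla X (nabla Y Z) p - nabla Y (nabla X Z) p - nabla (bracket X Y) Z p.

(* R(u, v)w for tangent vectors at p; by tensoriality the choice of the
   extensions of u, v, w to vector fields near p is immaterial. *)
Definition Riem p (u v w : 'rV[R]_d) : 'rV[R]_d :=
  curvature (const_field p u) (const_field p v) (const_field p w) p.

Definition Riem4 p (u v w z : 'rV[R]_d) : R := bil g p (Riem p u v w) z.

Definition Ric p (v w : 'rV[R]_d) : R :=
  \tr (lin1_mx (fun u => Riem p u v w)).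

Definition scal p : R :=
  \tr (invmx (g p) *m \matrix_(i, j) Ric p (unit_vec i) (unit_vec j)).

Definition einstein : Prop :=
  exists lambda : M -> R, forall p u v, Ric p u v = lambda p * bil g p u v.

End Tensors.

End VectorFields.

Arguments vfield {R d} M.

(* An almost paracontact metric structure.  Endomorphisms of T_pM act on row
   vectors from the right: phi(v) = v *m phi p, and eta(v) = v *m eta p.  The
   rank conditions say that the eigendistributions of phi on ker eta for the
   eigenvalues 1 and -1 both have rank n. *)
Record paracontact (R : realType) (n : nat) (M : smoothManifold R (2 * n).+1)
  := Paracontact {
  phi : M -> 'M[R]_((2 * n).+1);
  xi : vfield M;
  eta_mx : M -> 'cV[R]_((2 * n).+1);
  metric : M -> 'M[R]_((2 * n).+1);
  phi_smooth : forall W (X : vfield M), open W -> smooth_vfield W X ->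
    smooth_vfield W (fun p => X p *m phi p);
  xi_smooth : smooth_vfield setT xi;
  eta_smooth : forall W (X : vfield M), open W -> smooth_vfield W X ->
    smooth_fun W (fun p => (X p *m eta_mx p) 0 0);
  metric_pseudo_riemannian : pseudo_riemannian metric;
  phi_xi : forall p, xi p *m phi p = 0;
  eta_phi : forall p, phi p *m eta_mx p = 0;
  eta_xi : forall p, (xi p *m eta_mx p) 0 0 = 1;
  phi_phi : forall p v,
    v *m phi p *m phi p = v - (v *m eta_mx p) 0 0 *: xi p;
  metric_phi : forall p u v,
    bil metric p (u *m phi p) (v *m phi p) =
      - bil metric p u v + (u *m eta_mx p) 0 0 * (v *m eta_mx p) 0 0;
  rank_phi_plus : forall p,
    \rank (kermx (eta_mx p) :&: eigenspace (phi p) 1)%MS = n;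
  rank_phi_minus : forall p,
    \rank (kermx (eta_mx p) :&: eigenspace (phi p) (-1))%MS = n
}.

Section TransParaSasakian.
Context {R : realType} {n : nat} {M : smoothManifold R (2 * n).+1}.
Variables (S : paracontact M) (nabla : vfield M -> vfield M -> vfield M).

Definition eta p (v : 'rV[R]_((2 * n).+1)) : R := (v *m eta_mx S p) 0 0.

Definition trans_para_sasakian (alpha beta : M -> R) : Prop :=
  [/\ smooth_fun setT alpha, smooth_fun setT beta
    & forall W (X Y : vfield M) p, open W ->
        smooth_vfield W X -> smooth_vfield W Y -> W p ->
        nabla X (fun q => Y q *m phi S q) p - nabla X Y p *m phi S p =
          alpha p *: (- bil (metric S) p (X p) (Y p) *: xi S p
                      + eta p (Y p) *: X p)
          + beta p *: (bil (metric S) p (X p) (Y p *m phi S p) *: xi S p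
                       + eta p (Y p) *: (X p *m phi S p))].

Definition bochner4 p (X Y Z W : 'rV[R]_((2 * n).+1)) : R :=
  let g := bil (metric S) p in
  let ric := Ric nabla p in
  let f := fun v : 'rV[R]_((2 * n).+1) => v *m phi S p in
  let h := eta p in
  let N : R := n%:R in
  let k : R := - ((scal (metric S) nabla p - 2 * N) / (2 * N + 2)) in
  Riem4 (metric S) nabla p X Y Z W
  + 1 / (2 * N + 4) *
    (ric X Z * g Y W - ric Y Z * g X W
     + ric Y W * g X Z - ric X W * g Y Z + ric (f X) Z * g Y (f W)
     - ric (f Y) Z * g X (f W) + ric (f Y) W * g X (f Z)
     - ric (f X) W * g Y (f Z)
     + 2 * ric (f X) Y * g Z (f W) + 2 * ric (f Z) W * g X (f Y)
     - ric X Z * h Y * h W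
     + ric Y Z * h X * h W - ric Y W * h X * h Z + ric X W * h Y * h Z)
  + (k - 4) / (2 * N + 4) * (g X Z * g Y W - g Y Z * g X W)
  - (k + 2 * N) / (2 * N + 4) *
    (g Y (f W) * g X (f Z) - g X (f W) * g Y (f Z) + 2 * g X (f Y) * g Z (f W))
  - k / (2 * N + 4) *
    (g X Z * h Y * h W - g Y Z * h X * h W + g Y W * h X * h Z
     - g X W * h Y * h Z).

(* B(X, Y)Z, the vector such that g(B(X, Y)Z, W) = B(X, Y, Z, W) for all W. *)
Definition bochner p (X Y Z : 'rV[R]_((2 * n).+1)) : 'rV[R]_((2 * n).+1) :=
  sharp (metric S) p (bochner4 p X Y Z).

End TransParaSasakian.

(* Main.v *)
Require Import Defs.
From HB Require Import structures.
From mathcomp Require Import all_boot all_order all_algebra.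
From mathcomp Require Import all_classical all_reals all_analysis.
From mathcomp Require Import ring lra.
Import Order.TTheory GRing.Theory Num.Theory.
Import numFieldNormedType.Exports.
Set Implicit Arguments.
Unset Strict Implicit.
Unset Printing Implicit Defensive.
Local Open Scope classical_set_scope.
Local Open Scope ring_scope.

(** Write kappa = alpha^2 + beta^2, a = d alpha and b = d beta.

    The structure equation gives nabla_X xi = - alpha phi X - beta phi^2 X
    ([nabla_xi]), and differentiating once more expresses R(u, v) xi through
    a, b, alpha and beta ([cov2_commutator_xi], [Riem_xi]).  The symmetries of
    the Riemann tensor restrict a and b.  The operator R(xi, .) xi is
    self-adjoint, so a(xi) = 2 alpha beta; the gradient condition reads
    (2n - 1) b = a o phi, so b(xi) = 0; and the first Bianchi identity,
    contracted with phi, gives (2n - 2) a = 0 on ker eta.  For n > 1 this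
    kills a and b on ker eta.  For n = 1 the eigenspaces of phi on ker eta are
    lines, on which the terms in a and b cancel.  In both cases
    R(u, v) xi = - kappa (eta(v) u - eta(u) v) ([xi_curvature_formulaE]).

    Consequently Ric(xi, .) = - 2n kappa eta, and the Bochner tensor collapses
    to B(xi, Y) Z = c (eta(Z) Y - g(Y, Z) xi), where c is a multiple of
    kappa - 1 ([bochner_xi]).  Putting Z = xi in B(xi, Y) Ric = 0 leaves
    c (Ric + 2n kappa g) = 0, so at each point either kappa = 1 or
    Ric = - 2n kappa g ([einstein_or_unit]).

    It remains to see that the same alternative holds at all points, and for
    this that kappa is constant ([kappa_cst]).  The flow of xi preserves phi;
    in terms of Hessians,
    (2n - 1) Hess beta (xi, v) = Hess alpha (xi, phi v) ([hess_be_al]).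
    Symmetry of the Hessians turns this into alpha b + beta a = 0 on ker eta
    ([al_be_horizontal]), from which d kappa vanishes on ker eta, that is
    d kappa = 4 alpha^2 beta eta ([dkappa_eta]).  But d eta is 2 alpha times
    the form g(., phi .), which is nondegenerate on ker eta, so symmetry of
    the Hessian of kappa forces alpha^3 beta = 0, hence d kappa = 0
    ([dkappa0]).

    The geometric argument runs on fields that are constant in a chart: their
    brackets vanish ([bracket_const]), so every curvature term is a commutator
    of second covariant derivatives, and tensoriality ([tensorial]) transfers
    the result to xi and to phi X. *)

(** * Smooth functions of several real variables *)

(** The remainder of g at x is that of f on a neighbourhood of x, so the
    differential of f serves for g. *)
Lemma near_eq_differentiable (R : realType) (V W : normedModType R)
    (f g : V -> W) (x : V) :
  (\near x, f x = g x) -> differentiable f x -> differentiable g x.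
Proof.
move=> fg df.
have dg : g \o shift x = cst (g x) + 'd f x +o_ (0 : V) id.
  have /diff_locally/eqaddoP dff := df.
  apply/eqaddoP => e e0; have := dff e e0.
  have : \forall h \near 0, f (h + x) = g (h + x).
    by move: fg; rewrite (near_shift 0 x) subr0; apply: filterS.
  apply: filterS2 => h /= fgh.
  by rewrite /= !fctE /= fgh (nbhs_singleton fg).
apply/diff_locallyP.
by rewrite (diff_unique _ dg); [split=> //|]; exact: diff_continuous.
Qed.

Lemma open_near_eq (R : realType) (V W : normedModType R) (U : set V)
    (f g : V -> W) (x : V) :
  open U -> U x -> (forall y, U y -> f y = g y) -> \near x, f x = g x.
Proof. by move=> oU Ux fg; apply: filterS (open_nbhs_nbhs (conj oU Ux)). Qed.

Lemma differentiable_rV (R : realType) (V : normedModType R) (e : nat)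
    (psi : V -> 'rV[R]_e) (x : V) :
  (forall j, differentiable (fun y => psi y 0 j) x) -> differentiable psi x.
Proof.
move=> dpsi.
have -> : psi = \sum_(j < e) (fun y => psi y 0 j *: (delta_mx 0 j : 'rV[R]_e)).
  by apply/funext => y; rewrite fct_sumE [LHS]row_sum_delta.
by apply: differentiable_sum => j; apply: differentiableZl.
Qed.

Lemma derive_rV (R : realType) (V : normedModType R) (e : nat)
    (psi : V -> 'rV[R]_e) (x v : V) (j : 'I_e) :
  differentiable psi x -> 'D_v psi x 0 j = 'D_v (fun y => psi y 0 j) x.
Proof. by move=> dpsi; rewrite derive_mx ?mxE//; exact: diff_derivable. Qed.

Lemma derive_comp (R : realType) (U V W : normedModType R)
    (psi : U -> V) (F : V -> W) (x v : U) :
  differentiable psi x -> differentiable F (psi x) ->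
  'D_v (fun y => F (psi y)) x = 'D_('D_v psi x) F (psi x).
Proof.
move=> dpsi dF; rewrite -[fun y => _]/(F \o psi).
rewrite (deriveE _ dpsi) (deriveE _ dF) deriveE; first by rewrite diff_comp.
exact: differentiable_comp.
Qed.

Section PartialDerivatives.
Context {R : realType}.

Section Fixed.
Context {d : nat}.
Local Notation V := 'rV[R]_d.
Implicit Types (U : set V) (f g : V -> R) (x v : V).

Lemma derive_partial f x v : differentiable f x ->
  'D_v f x = \sum_i v 0 i * 'D_(unit_vec i) f x.
Proof.
move=> df; rewrite deriveE// {1}[v]row_sum_delta linear_sum.
by apply: eq_bigr => i _; rewrite linearZ deriveE.
Qed.

Lemma derive_linear (W : normedModType R) (f : V -> W) x (a : R) (u v : V) :
  differentiable f x -> 'D_(a *: u + v) f x = a *: 'D_u f x + 'D_v f x.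
Proof. by move=> df; rewrite !deriveE// linearP. Qed.

(** Differentiability up to order k + 1, with the partial derivatives peeled
    off from the inside, which suits induction on the order better than the
    list of directions in [iter_partial]. *)
Fixpoint ndiff (k : nat) U f : Prop :=
  (forall x, U x -> differentiable f x) /\
  if k is k'.+1 then forall i, ndiff k' U (fun x => 'D_(unit_vec i) f x)
  else True.

Lemma smooth_onP U f : smooth_on U f <-> forall k, ndiff k U f.
Proof.
split=> [sf k|nf s x].
  elim: k f sf => [|k IH] f sf /=; split=> //; try exact: (sf [::]).
  move=> i; apply: IH => s x Ux; have := sf (rcons s i) x Ux.
  by rewrite /iter_partial foldr_rcons.
elim/last_ind: s f nf => [|s i IH] f nf Ux; first by case: (nf 0) => + _; exact.
rewrite /iter_partial foldr_rcons; apply: IH Ux => k.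
by case: (nf k.+1) => _; exact.
Qed.

Lemma ndiff_eq k U f g : open U -> (forall x, U x -> f x = g x) ->
  ndiff k U f -> ndiff k U g.
Proof.
move=> oU; elim: k f g => [|k IH] f g fg [df H];
  (split; first by move=> x Ux; apply: near_eq_differentiable (df x Ux);
     exact: open_near_eq fg) => //.
move=> i; apply: IH (H i) => x Ux.
by apply: near_eq_derive; apply: open_near_eq fg.
Qed.

Lemma ndiffW k U f : ndiff k.+1 U f -> ndiff k U f.
Proof.
elim: k f => [|k IH] f [df H]; first by split.
by split=> // i; apply: IH; exact: H.
Qed.

Lemma ndiff_cst k U (a : R) : ndiff k U (fun=> a).
Proof.
elim: k a => [|k IH] a;
  (split; first by move=> x _; exact: differentiable_cst) => //.
move=> i; have -> : (fun x : V => 'D_(unit_vec i) (fun=> a) x) = (fun=> 0).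
  by apply/funext => x; exact: derive_cst.
exact: IH.
Qed.

Lemma ndiffD k U f g : open U -> ndiff k U f -> ndiff k U g ->
  ndiff k U (fun x => f x + g x).
Proof.
move=> oU; elim: k f g => [|k IH] f g [df Hf] [dg Hg];
  (split; first by move=> x Ux; apply: differentiableD; [exact: df|exact: dg])
  => //.
move=> i; apply: ndiff_eq (IH _ _ (Hf i) (Hg i)) => // x Ux.
by rewrite [RHS]deriveD//; apply: diff_derivable; [exact: df|exact: dg].
Qed.

Lemma ndiffM k U f g : open U -> ndiff k U f -> ndiff k U g ->
  ndiff k U (fun x => f x * g x).
Proof.
move=> oU; elim: k f g => [|k IH] f g nf ng.
  split=> // x Ux.
  by apply: differentiableM; [case: nf => + _|case: ng => + _]; exact.
have [df Hf] := nf; have [dg Hg] := ng.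
split=> [x Ux|i].
  by apply: differentiableM; [exact: df|exact: dg].
apply: ndiff_eq (ndiffD oU (IH _ _ (ndiffW nf) (Hg i))
                           (IH _ _ (ndiffW ng) (Hf i))) => // x Ux.
by rewrite [RHS]deriveM//; apply: diff_derivable; [exact: df|exact: dg].
Qed.

Lemma ndiff_sum k U (I : Type) (r : seq I) (F : I -> V -> R) : open U ->
  (forall i, ndiff k U (F i)) -> ndiff k U (fun x => \sum_(i <- r) F i x).
Proof.
move=> oU nF; elim: r => [|i r IH].
  apply: ndiff_eq (ndiff_cst k U 0) => // x _; by rewrite big_nil.
by apply: ndiff_eq (ndiffD oU (nF i) IH) => // x _; rewrite big_cons.
Qed.

End Fixed.

(** By the chain rule, the i-th partial derivative of F o psi is a sum of
    products of D_i psi_j with (D_j F) o psi, and the induction hypothesis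
    applies to the latter. *)
Lemma ndiff_comp (d e k : nat) (U : set 'rV[R]_d) (U' : set 'rV[R]_e)
    (psi : 'rV[R]_d -> 'rV[R]_e) (F : 'rV[R]_e -> R) : open U ->
  (forall x, U x -> U' (psi x)) ->
  (forall j, ndiff k U (fun x => psi x 0 j)) -> ndiff k U' F ->
  ndiff k U (fun x => F (psi x)).
Proof.
move=> oU psiU.
have dc f : (forall x, U' x -> differentiable f x) ->
    (forall j x, U x -> differentiable (fun y => psi y 0 j) x) ->
    forall x, U x -> differentiable (fun x : 'rV[R]_d => f (psi x) : R) x.
  move=> df dpsi x Ux; apply: differentiable_comp; last exact/df/psiU.
  by apply: differentiable_rV => j; exact: dpsi.
elim: k F => [|k IH] F npsi [dF HF].
  by split=> //; apply: dc => // j; case: (npsi j).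
have dpsi j x : U x -> differentiable (fun y => psi y 0 j) x.
  by case: (npsi j) => + _; exact.
split; first exact: dc.
move=> i.
have npsik j : ndiff k U (fun x => psi x 0 j) by exact: ndiffW.
have nDpsi j : ndiff k U (fun x => 'D_(unit_vec i) (fun y => psi y 0 j) x).
  by case: (npsi j) => _; exact.
apply: ndiff_eq (ndiff_sum (index_enum 'I_e) oU
  (fun j => ndiffM oU (nDpsi j) (IH _ npsik (HF j)))) => // x Ux.
have dpsix : differentiable psi x by apply: differentiable_rV => j; exact: dpsi.
rewrite derive_comp ?derive_partial//; try exact/dF/psiU.
by apply: eq_bigr => j _; rewrite derive_rV.
Qed.

End PartialDerivatives.

Section SmoothOn.
Context {R : realType} {d : nat}.
Local Notation V := 'rV[R]_d.
Implicit Types (U : set V) (f g : V -> R) (x v : V).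

Lemma smooth_on_differentiable U f x :
  smooth_on U f -> U x -> differentiable f x.
Proof. by move=> sf; exact: (sf [::]). Qed.

Lemma smooth_on_sub U U' f : U' `<=` U -> smooth_on U f -> smooth_on U' f.
Proof. by move=> sU sf s x /sU; exact: sf. Qed.

Lemma smooth_on_eq U f g : open U -> (forall x, U x -> f x = g x) ->
  smooth_on U f -> smooth_on U g.
Proof.
by move=> oU fg /smooth_onP sf; apply/smooth_onP => k; exact: ndiff_eq fg _.
Qed.

Lemma smooth_on_cst U (a : R) : smooth_on U (fun=> a).
Proof. by apply/smooth_onP => k; exact: ndiff_cst. Qed.

Lemma smooth_onD U f g : open U -> smooth_on U f -> smooth_on U g ->
  smooth_on U (fun x => f x + g x).
Proof.
by move=> oU /smooth_onP sf /smooth_onP sg; apply/smooth_onP => k; exact: ndiffD.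
Qed.

Lemma smooth_onM U f g : open U -> smooth_on U f -> smooth_on U g ->
  smooth_on U (fun x => f x * g x).
Proof.
by move=> oU /smooth_onP sf /smooth_onP sg; apply/smooth_onP => k; exact: ndiffM.
Qed.

Lemma smooth_on_sum U (I : Type) (r : seq I) (F : I -> V -> R) : open U ->
  (forall i, smooth_on U (F i)) -> smooth_on U (fun x => \sum_(i <- r) F i x).
Proof.
move=> oU sF; apply/smooth_onP => k; apply: ndiff_sum => // i.
by move: k; apply/smooth_onP.
Qed.

Lemma smooth_on_derive U f v : open U -> smooth_on U f ->
  smooth_on U (fun x => 'D_v f x).
Proof.
move=> oU sf.
apply: (@smooth_on_eq _ (fun x => \sum_i v 0 i * 'D_(unit_vec i) f x)) => //.
  by move=> x Ux; rewrite derive_partial//; exact: smooth_on_differentiable sf Ux.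
apply: smooth_on_sum => // i; apply: smooth_onM => //; first exact: smooth_on_cst.
by apply/smooth_onP => k; have /smooth_onP/(_ k.+1)[_] := sf; exact.
Qed.

Lemma smooth_on_comp (e : nat) U (U' : set 'rV[R]_e) (psi : V -> 'rV[R]_e)
    (F : 'rV[R]_e -> R) : open U -> (forall x, U x -> U' (psi x)) ->
  (forall j, smooth_on U (fun x => psi x 0 j)) -> smooth_on U' F ->
  smooth_on U (fun x => F (psi x)).
Proof.
move=> oU psiU spsi /smooth_onP sF; apply/smooth_onP => k.
by apply: (@ndiff_comp _ _ _ _ _ U') => // j; move: k; apply/smooth_onP.
Qed.

Lemma smooth_on_rV (e : nat) U (psi : V -> 'rV[R]_e) x :
  (forall j, smooth_on U (fun x => psi x 0 j)) -> U x -> differentiable psi x.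
Proof.
move=> spsi Ux; apply: differentiable_rV => j.
exact: smooth_on_differentiable (spsi j) Ux.
Qed.

End SmoothOn.

Section Schwarz.
Context {R : realType} {d : nat}.
Local Notation V := 'rV[R]_d.
Implicit Types (U : set V) (f g : V -> R) (x y u v : V).

Lemma deriveZ_dir f x (a : R) v : differentiable f x ->
  'D_(a *: v) f x = a * 'D_v f x.
Proof. by move=> df; rewrite !deriveE// linearZ. Qed.

(** The one-variable mean value theorem for t |-> f (x + t v). *)
Lemma line_MVT f x v :
  (forall t, 0 <= t <= 1 -> differentiable f (x + t *: v)) ->
  exists2 t, 0 <= t <= 1 & f (x + v) - f x = 'D_v f (x + t *: v).
Proof.
move=> df; pose l := fun t : R => x + t *: v.
have dl (t : R) : differentiable l t.
  by apply: differentiableD => //; exact: differentiableZl.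
have Dl (t : R) : 'D_1 l t = v.
  rewrite (@deriveD _ _ _ (fun=> x) (fun t : R => t *: v)).
  - rewrite (derive_cst x) add0r deriveE; last exact: differentiableZl.
    by rewrite diffZl//= diff_val scale1r.
  - exact: derivable_cst.
  - by apply: diff_derivable; exact: differentiableZl.
have dfl (t : R) : 0 <= t <= 1 -> is_derive t 1 (fun t => f (l t)) ('D_v f (l t)).
  move=> t01; apply: DeriveDef.
    by apply: diff_derivable; apply: differentiable_comp (dl t) _; exact: df.
  by rewrite derive_comp ?Dl//; exact: df.
have [] := @MVT_segment R (fun t => f (l t)) (fun t => 'D_v f (l t)) 0 1 ler01.
- by move=> t /[!in_itv]/= /andP[/ltW t0 /ltW t1]; apply: dfl; rewrite t0.
- apply: derivable_within_continuous => t /[!in_itv]/= t01.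
  by have [] := dfl t t01.
move=> t /[!in_itv]/= t01; rewrite /l scale1r scale0r addr0 subr0 mulr1 => e.
by exists t.
Qed.

(** Two applications of [line_MVT]: first to y |-> f (y + v) - f y along u,
    then to D_u f along v. *)
Lemma second_difference U f x u v : smooth_on U f -> open U ->
  (forall s t, 0 <= s <= 1 -> 0 <= t <= 1 -> U (x + s *: u + t *: v)) ->
  exists s t, [/\ 0 <= s <= 1, 0 <= t <= 1 &
    f (x + u + v) - f (x + u) - f (x + v) + f x =
    'D_v (fun y => 'D_u f y) (x + s *: u + t *: v)].
Proof.
move=> sf oU segU.
have df y : U y -> differentiable f y by exact: smooth_on_differentiable.
have U0 s : 0 <= s <= 1 -> U (x + s *: u).
  by move=> s01; rewrite -[_ + _]addr0 -(scale0r v); apply: segU; rewrite ?lexx ?ler01.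
have U1 s : 0 <= s <= 1 -> U (x + s *: u + v).
  by move=> s01; rewrite -(scale1r v); apply: segU; rewrite ?lexx ?ler01.
pose g y := f (y + v) - f y.
have dfv s : 0 <= s <= 1 -> differentiable (fun y => f (y + v)) (x + s *: u).
  by move=> s01; apply: differentiable_comp; [exact: differentiableD|exact/df/U1].
have [|s s01 gE] := @line_MVT g x u.
  by move=> s s01; apply: differentiableB; [exact: dfv|exact/df/U0].
have [|t t01 fE] := @line_MVT (fun y => 'D_u f y) (x + s *: u) v.
  move=> t t01; apply: smooth_on_differentiable (segU _ _ s01 t01).
  exact: smooth_on_derive.
exists s, t; split=> //; rewrite -fE.
have -> : 'D_u f (x + s *: u + v) - 'D_u f (x + s *: u) = 'D_u g (x + s *: u).
  rewrite /g [RHS]deriveB.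
  - congr (_ - _); rewrite (@derive_comp _ _ _ _ (fun y => y + v)).
    + congr ('D_(_) f _); rewrite (@deriveD _ _ _ id (cst v)) ?derive_id ?derive_cst ?addr0//.
    + exact: differentiableD.
    + exact/df/U1.
  - by apply: diff_derivable; exact: dfv.
  - by apply: diff_derivable; exact/df/U0.
by rewrite -gE /g; ring.
Qed.

(** The second difference of [second_difference] is symmetric in u and v.
    At scale h it equals h^2 times a value of D_v D_u f near x, and also h^2
    times a value of D_u D_v f near x; continuity of both at x concludes. *)
Lemma derive_sym U f x u v : smooth_on U f -> open U -> U x ->
  'D_v (fun y => 'D_u f y) x = 'D_u (fun y => 'D_v f y) x.
Proof.
move=> sf oU Ux.
have df y : U y -> differentiable f y by exact: smooth_on_differentiable.
have sDD w w' : smooth_on U (fun y => 'D_w' (fun y => 'D_w f y) y).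
  by apply: smooth_on_derive => //; exact: smooth_on_derive.
apply/eqP; rewrite -subr_eq0 -normr_le0; apply/ler_addgt0Pl => e e0; rewrite addr0.
have e20 : 0 < e / 2 by rewrite divr_gt0.
have near2 w w' : \forall y \near x,
    `|'D_w' (fun y => 'D_w f y) x - 'D_w' (fun y => 'D_w f y) y| < e / 2.
  have /differentiable_continuous := smooth_on_differentiable (sDD w w') Ux.
  by move/cvgrPdist_lt; exact.
have /nbhs_ballP[r r0 Br] : \forall y \near x, [/\ U y,
    `|'D_v (fun y => 'D_u f y) x - 'D_v (fun y => 'D_u f y) y| < e / 2 &
    `|'D_u (fun y => 'D_v f y) x - 'D_u (fun y => 'D_v f y) y| < e / 2].
  apply: filterS3 (open_nbhs_nbhs (conj oU Ux)) (near2 u v) (near2 v u) => y.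
  by split.
(* The scale h keeps the parallelogram spanned by h u and h v in the ball. *)
have [h h0 hr] : exists2 h, 0 < h & h * (`|u| + `|v|) < r.
  have n0 : 0 < 1 + (`|u| + `|v|) by rewrite ltr_wpDr// addr_ge0.
  exists (r / (1 + (`|u| + `|v|))); first by rewrite divr_gt0.
  by rewrite mulrAC ltr_pdivrMr// ltr_pM2l// ltrDr.
have inB w w' s t : `|w| + `|w'| = `|u| + `|v| -> 0 <= s <= 1 -> 0 <= t <= 1 ->
    ball x r (x + s *: (h *: w) + t *: (h *: w')).
  move=> ww /andP[s0 s1] /andP[t0 t1].
  rewrite -ball_normE /ball_ /= -addrA opprD addrA subrr add0r normrN.
  apply: le_lt_trans (ler_normD _ _) _; rewrite !normrZ.
  rewrite (ger0_norm s0) (ger0_norm t0) (gtr0_norm h0).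
  apply: (@le_lt_trans _ _ (h * `|w| + h * `|w'|)).
    by apply: lerD; rewrite ler_piMl// mulr_ge0// ltW.
  by rewrite -mulrDr ww.
have key w w' : `|w| + `|w'| = `|u| + `|v| -> exists2 y, ball x r y &
    f (x + h *: w + h *: w') - f (x + h *: w) - f (x + h *: w') + f x
    = h * (h * 'D_w' (fun y => 'D_w f y) y).
  move=> ww; have [|s [t [s01 t01 ->]]] := @second_difference U f x (h *: w) (h *: w') sf oU.
    by move=> s t s01 t01; case: (Br _ (inB _ _ _ _ ww s01 t01)).
  exists (x + s *: (h *: w) + t *: (h *: w')); first exact: inB.
  set y := (x + _ + _).
  have Uy : U y by case: (Br _ (inB _ _ _ _ ww s01 t01)).
  have dDf : differentiable (fun y => 'D_w f y) y.
    exact: smooth_on_differentiable (smooth_on_derive _ oU sf) Uy.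
  rewrite -deriveZ_dir//.
  rewrite (@near_eq_derive _ _ _ _ (fun y => h * 'D_w f y)); last first.
    by apply: (open_near_eq oU Uy) => z Uz; rewrite deriveZ_dir//; exact: df.
  by rewrite (@deriveZ _ _ _ (fun y => 'D_w f y))//; exact: diff_derivable.
have [y /Br[_ y1 _] E1] := key u v erefl.
have [z /Br[_ _ z1]] := key v u (addrC _ _).
rewrite (addrAC x) (addrAC (f _)) E1 => /(mulfI (lt0r_neq0 h0)) /(mulfI (lt0r_neq0 h0)) yz.
move: y1 z1 yz.
move: ('D_v _ x) ('D_u _ x) ('D_v _ y) ('D_u _ z) => a b a' b' + + ab.
by rewrite -{}ab ltr_norml ltr_norml ler_norml; lra.
Qed.

Lemma derive0_near_cst U f x : open U -> U x ->
  (forall y, U y -> differentiable f y) ->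
  (forall y v, U y -> 'D_v f y = 0) -> \forall y \near x, f y = f x.
Proof.
move=> oU Ux df Df0.
have /nbhs_ballP[r r0 Br] : nbhs x U by exact: open_nbhs_nbhs.
apply/nbhs_ballP; exists r => // y xy.
have inB t : 0 <= t <= 1 -> U (x + t *: (y - x)).
  move=> /andP[t0 t1]; apply: Br; move: xy; rewrite -ball_normE /ball_ /=.
  rewrite opprD addrA subrr add0r normrN normrZ ger0_norm// distrC.
  by apply: le_lt_trans; rewrite ler_piMl.
have [|t t01] := @line_MVT f x (y - x); first by move=> t /inB/df.
by rewrite subrKC Df0; [move/eqP; rewrite subr_eq0 => /eqP|exact: inB].
Qed.

End Schwarz.

(** * Functions on a manifold, read in charts *)
Section Charts.
Context {R : realType} {d : nat} {M : smoothManifold R d}.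
Implicit Types (c : chart R d M) (f g : M -> R) (W : set M) (p q : M).

Definition dchart {V : normedModType R} c (f : M -> V) q (v : 'rV[R]_d) : V :=
  'D_v (f \o cinv c) (cmap c q).

(** The coordinate change of tangent vectors at q.  Both [components] and
    [const_field] are instances of it. *)
Definition push c c' q v : 'rV[R]_d := dchart c (cmap c') q v.

Lemma open_cdom c : atlas c -> open (cdom c).
Proof. by case/atlas_is_chart. Qed.

Lemma chartK c p : atlas c -> cdom c p -> cinv c (cmap c p) = p.
Proof. by case/atlas_is_chart => _ _ + _ _; exact. Qed.

Lemma chart_imageI_open c W : atlas c -> open W ->
  open (cmap c @` (cdom c `&` W)).
Proof.
move=> ac oW; have [oc oi cK _ ci] := atlas_is_chart ac.
have -> : cmap c @` (cdom c `&` W) = cimage c `&` cinv c @^-1` W.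
  apply/seteqP; split=> [_ [q [cq Wq] <-]|_ [[q cq <-] /=]].
    by split; [exists q|rewrite /= cK].
  by rewrite cK// => Wq; exists q.
by apply: (continuous_inP _ oi).1 => //; rewrite -continuous_open_subspace.
Qed.

Lemma chart_image_open c W : atlas c -> open W -> W `<=` cdom c ->
  open (cmap c @` W).
Proof.
by move=> ac oW Wc; have := chart_imageI_open ac oW; rewrite setIidr.
Qed.

Lemma trans_smooth c c' j : atlas c -> atlas c' ->
  smooth_on (cmap c @` (cdom c `&` cdom c')) (fun x => cmap c' (cinv c x) 0 j).
Proof. by move=> ac ac'; exact: atlas_smooth. Qed.

Lemma trans_differentiable c c' q : atlas c -> atlas c' -> cdom c q ->
  cdom c' q -> differentiable (cmap c' \o cinv c) (cmap c q).
Proof.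
move=> ac ac' cq cq'.
apply: (@smooth_on_rV _ _ _ (cmap c @` (cdom c `&` cdom c'))); last by exists q.
by move=> j; exact: trans_smooth.
Qed.

(** The chain rule for f o cinv c = (f o cinv c') o (cmap c' o cinv c). *)
Lemma dchart_push (V : normedModType R) (f : M -> V) c c' q v : atlas c ->
  atlas c' -> cdom c q -> cdom c' q ->
  differentiable (f \o cinv c') (cmap c' q) ->
  dchart c f q v = dchart c' f q (push c c' q v).
Proof.
move=> ac ac' cq cq' df; rewrite /dchart.
have cqK : (cmap c' \o cinv c) (cmap c q) = cmap c' q by rewrite /= chartK.
rewrite (@near_eq_derive _ _ _ _ (fun x => (f \o cinv c') ((cmap c' \o cinv c) x))).
  rewrite derive_comp ?cqK//.
  exact: trans_differentiable.
apply: (@open_near_eq _ _ _ (cmap c @` (cdom c `&` cdom c'))).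
- by apply: chart_imageI_open => //; exact: open_cdom.
- by exists q.
- by move=> _ [r [cr cr'] <-]; rewrite /= (chartK ac)// chartK.
Qed.

Lemma push_comp c c' c'' q v : atlas c -> atlas c' -> atlas c'' ->
  cdom c q -> cdom c' q -> cdom c'' q ->
  push c' c'' q (push c c' q v) = push c c'' q v.
Proof.
by move=> *; rewrite [RHS](@dchart_push _ _ c c')//; exact: trans_differentiable.
Qed.

Lemma push_id c q v : atlas c -> cdom c q -> push c c q v = v.
Proof.
move=> ac cq; rewrite /push /dchart.
rewrite (@near_eq_derive _ _ _ _ id) ?derive_id//.
apply: (@open_near_eq _ _ _ (cmap c @` cdom c)).
- by apply: chart_image_open => //; exact: open_cdom.
- by exists q.
- by move=> _ [r cr <-]; rewrite /= chartK.
Qed.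

Lemma push_linear c c' q (a : R) u v : atlas c -> atlas c' -> cdom c q ->
  cdom c' q -> push c c' q (a *: u + v) = a *: push c c' q u + push c c' q v.
Proof. by move=> *; apply: derive_linear; exact: trans_differentiable. Qed.

Lemma pushD c c' q u v : atlas c -> atlas c' -> cdom c q ->
  cdom c' q -> push c c' q (u + v) = push c c' q u + push c c' q v.
Proof. by move=> *; rewrite -{1}(scale1r u) push_linear// scale1r. Qed.

Lemma pushZ c c' q (a : R) v : atlas c -> atlas c' -> cdom c q ->
  cdom c' q -> push c c' q (a *: v) = a *: push c c' q v.
Proof.
move=> ac ac' cq cq'; have E := push_linear a v 0 ac ac' cq cq'.
have p0 : push c c' q 0 = 0 by exact: derive0.
by rewrite addr0 p0 addr0 in E.
Qed.

(** Smoothness in one chart suffices, since the transition functions are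
    smooth and smooth functions compose. *)
Lemma smooth_fun_chart c W f : atlas c -> open W -> W `<=` cdom c ->
  smooth_on (cmap c @` W) (f \o cinv c) -> smooth_fun W f.
Proof.
move=> ac oW Wc sf c' ac'.
have oU := chart_imageI_open ac' oW.
apply: (@smooth_on_eq _ _ _ (fun x => (f \o cinv c) ((cmap c \o cinv c') x))) => //.
  by move=> _ [q [cq Wq] <-]; rewrite /= (chartK ac')// chartK//; exact: Wc.
apply: smooth_on_comp sf => //.
  by move=> _ [q [cq Wq] <-]; exists q => //=; rewrite chartK.
move=> j; apply: smooth_on_sub (trans_smooth j ac' ac).
by move=> _ [q [cq Wq] <-]; exists q => //; split=> //; exact: Wc.
Qed.

Lemma smooth_fun_sub W W' f : W' `<=` W -> smooth_fun W f -> smooth_fun W' f.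
Proof.
move=> sW sf c ac; apply: smooth_on_sub (sf c ac).
by move=> _ [q [cq Wq] <-]; exists q => //; split=> //; exact: sW.
Qed.

Lemma smooth_fun_differentiable W f c p : smooth_fun W f -> W p ->
  atlas c -> cdom c p -> differentiable (f \o cinv c) (cmap c p).
Proof.
by move=> sf Wp ac cp; apply: smooth_on_differentiable (sf c ac) _; exists p.
Qed.

Lemma smooth_fun_eq W f g : open W -> (forall p, W p -> f p = g p) ->
  smooth_fun W f -> smooth_fun W g.
Proof.
move=> oW fg sf c ac; apply: smooth_on_eq (sf c ac).
  exact: chart_imageI_open.
by move=> _ [q [cq Wq] <-]; rewrite /= chartK// fg.
Qed.

Lemma smooth_fun_cst W (a : R) : smooth_fun W (fun=> a).
Proof. by move=> c ac; exact: smooth_on_cst. Qed.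

Lemma smooth_funD W f g : open W -> smooth_fun W f -> smooth_fun W g ->
  smooth_fun W (fun q => f q + g q).
Proof.
move=> oW sf sg c ac; have oU := chart_imageI_open ac oW.
exact: (smooth_onD oU (sf c ac) (sg c ac)).
Qed.

Lemma smooth_funM W f g : open W -> smooth_fun W f -> smooth_fun W g ->
  smooth_fun W (fun q => f q * g q).
Proof.
move=> oW sf sg c ac; have oU := chart_imageI_open ac oW.
exact: (smooth_onM oU (sf c ac) (sg c ac)).
Qed.

Lemma dfun_chart f c q v W : smooth_fun W f -> W q -> atlas c ->
  cdom c q -> dchart c f q v = dfun f q (push c (chart_at q) q v).
Proof.
move=> sf Wq ac cq; apply: dchart_push => //.
- exact: chart_at_atlas.
- exact: chart_at_dom.
- apply: smooth_fun_differentiable sf Wq _ _; first exact: chart_at_atlas.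
  exact: chart_at_dom.
Qed.

End Charts.

(** * Vector fields and differentiation *)
Section VectorFieldCalculus.
Context {R : realType} {d : nat} {M : smoothManifold R d}.
Implicit Types (c : chart R d M) (f g : M -> R) (W : set M) (p q : M).
Implicit Types (X Y Z : vfield M) (u v : 'rV[R]_d).

Lemma atlas_chart_at p : atlas (chart_at p).
Proof. exact: chart_at_atlas. Qed.

Lemma open_cdom_at p : open (cdom (chart_at p)).
Proof. exact/open_cdom/atlas_chart_at. Qed.

Hint Resolve atlas_chart_at chart_at_dom open_cdom_at : core.

Lemma vfield_inE c X q : atlas c -> cdom c q ->
  vfield_in c X (cmap c q) = push (chart_at q) c q (X q).
Proof. by move=> ac cq; rewrite /vfield_in chartK. Qed.

Lemma smooth_vfield_sub W W' X :
  W' `<=` W -> smooth_vfield W X -> smooth_vfield W' X.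
Proof.
move=> sW sX c ac j; apply: smooth_on_sub (sX c ac j).
by move=> _ [q [cq Wq] <-]; exists q => //; split=> //; exact: sW.
Qed.

Lemma smooth_vfield_eq W X Y : open W -> (forall p, W p -> X p = Y p) ->
  smooth_vfield W X -> smooth_vfield W Y.
Proof.
move=> oW XY sX c ac j; apply: smooth_on_eq (sX c ac j).
  exact: chart_imageI_open.
move=> _ [q [cq Wq] <-].
by rewrite !(vfield_inE _ ac cq) XY.
Qed.

Lemma smooth_vfieldD W X Y : open W -> smooth_vfield W X ->
  smooth_vfield W Y -> smooth_vfield W (fun q => X q + Y q).
Proof.
move=> oW sX sY c ac j; have oU := chart_imageI_open ac oW.
apply: smooth_on_eq (smooth_onD oU (sX c ac j) (sY c ac j)) => //.
move=> _ [q [cq Wq] <-].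
by rewrite !(vfield_inE _ ac cq) pushD ?mxE.
Qed.

Lemma smooth_vfieldZ W f X : open W -> smooth_fun W f ->
  smooth_vfield W X -> smooth_vfield W (fun q => f q *: X q).
Proof.
move=> oW sf sX c ac j; have oU := chart_imageI_open ac oW.
apply: smooth_on_eq (smooth_onM oU (sf c ac) (sX c ac j)) => //.
move=> _ [q [cq Wq] <-]; rewrite !vfield_inE//= chartK//.
by rewrite pushZ// mxE.
Qed.

Lemma smooth_vfield0 W : open W -> smooth_vfield W (fun=> 0 : 'rV[R]_d).
Proof.
move=> oW c ac j; have oU := chart_imageI_open ac oW.
apply: (@smooth_on_eq _ _ _ (fun=> 0)) => //; last exact: smooth_on_cst.
move=> _ [q [cq Wq] <-].
by rewrite vfield_inE// /push /dchart derive0 mxE.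
Qed.

Lemma smooth_vfield_sum W (I : Type) (r : seq I) (F : I -> vfield M) :
  open W -> (forall i, smooth_vfield W (F i)) ->
  smooth_vfield W (fun q => \sum_(i <- r) F i q).
Proof.
move=> oW sF; elim: r => [|i r IH].
  by apply: smooth_vfield_eq (smooth_vfield0 oW) => // q _; rewrite big_nil.
apply: smooth_vfield_eq (smooth_vfieldD oW (sF i) IH) => // q _.
by rewrite big_cons.
Qed.

Section Derivative.
Variables (W : set M) (oW : open W).

Lemma dfun_diff f p : smooth_fun W f -> W p ->
  differentiable (f \o cinv (chart_at p)) (cmap (chart_at p) p).
Proof. by move=> sf Wp; exact: smooth_fun_differentiable sf Wp _ _. Qed.

Lemma dfun_linear f p (a : R) u v : smooth_fun W f -> W p ->
  dfun f p (a *: u + v) = a * dfun f p u + dfun f p v.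
Proof. by move=> sf Wp; rewrite /dfun derive_linear//; exact: dfun_diff. Qed.

Lemma dfun_eq f g p v : W p -> (forall q, W q -> f q = g q) ->
  dfun f p v = dfun g p v.
Proof.
move=> Wp fg; apply: near_eq_derive.
apply: (@open_near_eq _ _ _ (cmap (chart_at p) @` (cdom (chart_at p) `&` W))).
- exact: chart_imageI_open.
- by exists p.
- by move=> _ [q [cq Wq] <-]; rewrite /= chartK// fg.
Qed.

Lemma dfun_cst (a : R) p v : dfun (fun=> a : R) p v = 0 :> R.
Proof. exact: derive_cst. Qed.

Lemma dfunD f g p v : smooth_fun W f -> smooth_fun W g -> W p ->
  dfun (fun q => f q + g q) p v = dfun f p v + dfun g p v.
Proof.
by move=> sf sg Wp; rewrite /dfun -deriveD//; apply: diff_derivable; exact: dfun_diff.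
Qed.

Lemma dfunM f g p v : smooth_fun W f -> smooth_fun W g -> W p ->
  dfun (fun q => f q * g q) p v = f p * dfun g p v + g p * dfun f p v.
Proof.
move=> sf sg Wp; have := @deriveM _ _ (f \o cinv (chart_at p))
  (g \o cinv (chart_at p)) (cmap (chart_at p) p) v.
rewrite /dfun => ->; [|by apply: diff_derivable; exact: dfun_diff..].
by rewrite /= chartK.
Qed.

End Derivative.

Lemma const_field_id p v : const_field p v p = v.
Proof. exact: push_id. Qed.

Lemma const_field_sum p q v : cdom (chart_at p) q ->
  const_field p v q = \sum_i v 0 i *: const_field p (unit_vec i) q.
Proof.
move=> cq; have df : differentiable (cmap (chart_at q) \o cinv (chart_at p)) (cmap (chart_at p) q).
  exact: trans_differentiable.
rewrite /const_field [LHS]deriveE// {1}[v]row_sum_delta linear_sum.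
by apply: eq_bigr => i _; rewrite linearZ deriveE.
Qed.

(** Vectors at q are represented in the chart chosen at q, so they have to be
    pushed to the chart at p before a field constant in that chart can take
    them as value. *)
Lemma const_fieldK p q v : cdom (chart_at p) q ->
  const_field p (push (chart_at q) (chart_at p) q v) q = v.
Proof.
move=> cq; rewrite -[LHS]/(push _ _ _ _) push_comp//.
by rewrite push_id.
Qed.

(** In another chart c the j-th component is the directional derivative of the
    j-th coordinate of c, composed with a transition function. *)
Lemma const_field_smooth p v : smooth_vfield (cdom (chart_at p)) (const_field p v).
Proof.
move=> c ac j; set c0 := chart_at p.
have ac0 : atlas c0 by exact: chart_at_atlas.
have oU : open (cmap c @` (cdom c `&` cdom c0)).
  by apply: chart_imageI_open => //; exact: open_cdom_at.
have oU' : open (cmap c0 @` (cdom c0 `&` cdom c)).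
  by apply: chart_imageI_open => //; exact: open_cdom.
have sH := smooth_on_derive v oU' (trans_smooth j ac0 ac).
apply: smooth_on_eq (smooth_on_comp (psi := cmap c0 \o cinv c) oU _ _ sH) => //.
- move=> _ [q [cq c0q] <-]; rewrite vfield_inE// [push _ _ _ _]push_comp//.
  rewrite /= chartK// /push /dchart derive_rV//; exact: trans_differentiable.
- by move=> _ [q [cq c0q] <-]; exists q => //=; rewrite chartK.
- by move=> i; exact: trans_smooth.
Qed.

Lemma dfun_const_field W f p q v : smooth_fun W f -> W q ->
  cdom (chart_at p) q ->
  dfun f q (const_field p v q) = dchart (chart_at p) f q v.
Proof. by move=> sf Wq cq; rewrite (dfun_chart _ sf Wq _ cq). Qed.

Lemma smooth_dfun_const W f p v : open W -> W `<=` cdom (chart_at p) ->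
  smooth_fun W f -> smooth_fun W (fun q => dfun f q (const_field p v q)).
Proof.
move=> oW Wp sf; apply: (smooth_fun_chart (atlas_chart_at p)) => //.
have oU : open (cmap (chart_at p) @` W) by exact: chart_image_open.
have sfp : smooth_on (cmap (chart_at p) @` W) (f \o cinv (chart_at p)).
  by rewrite -(setIidr Wp); exact: sf.
apply: smooth_on_eq (smooth_on_derive v oU sfp) => // _ [q Wq <-] /=.
have cq := Wp _ Wq.
by rewrite (chartK (atlas_chart_at p) cq) (dfun_const_field v sf Wq cq).
Qed.

(** In the chart at p, differentiation along constant fields is directional
    differentiation along constant vectors, and [derive_sym] applies. *)
Lemma dfun_const_sym W f p q u v : open W -> W `<=` cdom (chart_at p) ->
  smooth_fun W f -> W q ->
  dfun (fun r => dfun f r (const_field p v r)) q (const_field p u q) =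
  dfun (fun r => dfun f r (const_field p u r)) q (const_field p v q).
Proof.
move=> oW Wp sf Wq; have cq := Wp _ Wq.
have oU : open (cmap (chart_at p) @` W) by exact: chart_image_open.
have sfp : smooth_on (cmap (chart_at p) @` W) (f \o cinv (chart_at p)).
  by rewrite -(setIidr Wp); exact: sf.
have key w w' : dfun (fun r => dfun f r (const_field p w' r)) q (const_field p w q)
    = 'D_w (fun x => 'D_w' (f \o cinv (chart_at p)) x) (cmap (chart_at p) q).
  have sD := smooth_dfun_const w' oW Wp sf.
  rewrite (dfun_const_field w sD Wq cq) /dchart.
  apply: near_eq_derive; apply: (@open_near_eq _ _ _ (cmap (chart_at p) @` W)) => //.
  move=> _ [r Wr <-] /=; have cr := Wp _ Wr.
  by rewrite (chartK (atlas_chart_at p) cr) (dfun_const_field w' sf Wr cr).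
have Ux : (cmap (chart_at p) @` W) (cmap (chart_at p) q) by exists q.
have E := derive_sym v u sfp oU Ux.
exact (etrans (key u v) (etrans E (esym (key v u)))).
Qed.

(** The j-th component of the bracket is its action on the j-th coordinate
    function, which vanishes by [dfun_const_sym]. *)
Lemma bracket_const p u v q : cdom (chart_at p) q ->
  bracket (const_field p u) (const_field p v) q = 0.
Proof.
move=> cq; rewrite /bracket; set c := chart_at q; set c0 := chart_at p.
have cqc : cdom c q by exact: chart_at_dom.
have ac : atlas c by exact: chart_at_atlas.
have ac0 : atlas c0 by exact: chart_at_atlas.
have oW : open (cdom c0 `&` cdom c) by apply: openI; exact: open_cdom_at.
have sx j : smooth_fun (cdom c0 `&` cdom c) (fun r => cmap c r 0 j).
  apply: (@smooth_fun_sub _ _ _ (cdom c)) => [r []//|].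
  by move=> c' ac'; exact: trans_smooth.
have key w w' j : 'D_(const_field p w q) (vfield_in c (const_field p w')) (cmap c q) 0 j
    = dfun (fun r => dfun (fun r => cmap c r 0 j) r (const_field p w' r)) q (const_field p w q).
  rewrite derive_rV; last first.
    apply: (@smooth_on_rV _ _ _ (cmap c @` (cdom c `&` cdom c0))); last by exists q.
    by move=> i; exact: const_field_smooth.
  apply: near_eq_derive.
  apply: (@open_near_eq _ _ _ (cmap c @` (cdom c `&` cdom c0))).
  - by apply: chart_imageI_open => //; exact: open_cdom_at.
  - by exists q.
  - move=> _ [r [cr c0r] <-]; rewrite vfield_inE//= chartK//.
    by rewrite /dfun derive_rV//; exact: trans_differentiable.
apply/rowP => j; rewrite !mxE.
have Wq : (cdom c0 `&` cdom c) q by [].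
apply/eqP; rewrite subr_eq0; apply/eqP.
have sW : cdom c0 `&` cdom c `<=` cdom c0 by move=> r [].
have E := dfun_const_sym u v oW sW (sx j) Wq.
exact (etrans (key u v j) (etrans E (esym (key v u j)))).
Qed.

Lemma frame_expansion p X : smooth_vfield (cdom (chart_at p)) X ->
  exists F : 'I_d -> M -> R,
    [/\ forall i, smooth_fun (cdom (chart_at p)) (F i),
        forall q, cdom (chart_at p) q ->
          X q = \sum_i F i q *: const_field p (unit_vec i) q
      & forall i, F i p = X p 0 i].
Proof.
move=> sX; have ac : atlas (chart_at p) by exact: chart_at_atlas.
pose F i q := push (chart_at q) (chart_at p) q (X q) 0 i; exists F; split.
- move=> i; apply: (smooth_fun_chart ac) => //.
  have := sX _ ac i; rewrite setIid; apply: smooth_on_eq.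
    by apply: chart_image_open => //; exact: open_cdom_at.
  move=> _ [q Wq <-].
  have -> : (F i \o cinv (chart_at p)) (cmap (chart_at p) q) = F i q.
    by rewrite /= chartK.
  by rewrite (vfield_inE _ ac Wq).
- by move=> q Wq; rewrite -const_field_sum// const_fieldK.
- by move=> i; rewrite /F push_id.
Qed.

Lemma smooth_dfun p f X : smooth_fun (cdom (chart_at p)) f ->
  smooth_vfield (cdom (chart_at p)) X ->
  smooth_fun (cdom (chart_at p)) (fun q => dfun f q (X q)).
Proof.
move=> sf sX; have [F [sF XE _]] := frame_expansion sX.
set W := cdom (chart_at p) in sf sX sF XE *.
have oW : open W by exact: open_cdom_at.
have sG : smooth_fun W (fun q => \sum_i F i q * dfun f q (const_field p (unit_vec i) q)).
  elim: (index_enum _) => [|i r IH].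
    apply: (@smooth_fun_eq _ _ _ W (fun=> 0 : R) _ oW).
      by move=> q _; rewrite big_nil.
    exact: smooth_fun_cst.
  have sD : smooth_fun W (fun q => dfun f q (const_field p (unit_vec i) q)).
    exact: smooth_dfun_const.
  apply: smooth_fun_eq (smooth_funD oW (smooth_funM oW (sF i) sD) IH) => // q _.
  by rewrite big_cons.
apply: smooth_fun_eq sG => // q Wq; rewrite (XE q Wq).
have df := dfun_diff sf Wq.
rewrite /dfun [RHS]deriveE// linear_sum; apply: eq_bigr => i _.
by rewrite linearZ /= deriveE.
Qed.

(** An operator that is function-linear at p is local: X and Y become equal
    once multiplied by the indicator function of W, which is smooth on W. *)
Lemma op_local (V : lmodType R) (L : vfield M -> V) W p X Y : open W -> W p ->
  (forall f X, smooth_fun W f -> smooth_vfield W X ->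
    L (fun q => f q *: X q) = f p *: L X) ->
  smooth_vfield W X -> (forall q, W q -> X q = Y q) -> L X = L Y.
Proof.
move=> oW Wp LZ sX XY; pose f q : R := (q \in W)%:R.
have sf : smooth_fun W f.
  apply: (@smooth_fun_eq _ _ _ W (fun=> 1)) => //.
    by move=> q Wq; rewrite /f mem_set.
  exact: smooth_fun_cst.
have sY : smooth_vfield W Y by apply: smooth_vfield_eq sX.
have fp : f p = 1 by rewrite /f mem_set.
rewrite -[LHS]scale1r -[RHS]scale1r -fp -!LZ//; congr L.
apply/funext => q; rewrite /f; case: (boolP (q \in W)) => [/set_mem/XY->//|_].
by rewrite !scale0r.
Qed.

Section Tensorial.
Variables (p : M) (V : lmodType R) (L : vfield M -> V).
Let W := cdom (chart_at p).
Hypothesis LD : forall X Y, smooth_vfield W X -> smooth_vfield W Y ->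
  L (fun q => X q + Y q) = L X + L Y.
Hypothesis LZ : forall f X, smooth_fun W f -> smooth_vfield W X ->
  L (fun q => f q *: X q) = f p *: L X.

Lemma op_sum (F : 'I_d -> M -> R) (E : 'I_d -> vfield M) :
  (forall i, smooth_fun W (F i)) -> (forall i, smooth_vfield W (E i)) ->
  L (fun q => \sum_i F i q *: E i q) = \sum_i F i p *: L (E i).
Proof.
move=> sF sE; have sFE i : smooth_vfield W (fun q => F i q *: E i q).
  by apply: smooth_vfieldZ => //; exact: open_cdom_at.
elim: (index_enum _) => [|i r IH].
  rewrite big_nil (_ : (fun q => _) = (fun q => (0 : R) *: (0 : 'rV[R]_d))).
    rewrite (@LZ (fun=> 0) (fun=> 0)) ?scale0r//; first exact: smooth_fun_cst.
    by apply: smooth_vfield0; exact: open_cdom_at.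
  by apply/funext => q; rewrite big_nil scale0r.
rewrite big_cons -IH -LZ// -LD//; first last.
  by apply: smooth_vfield_sum => //; exact: open_cdom_at.
by congr L; apply/funext => q; rewrite big_cons.
Qed.

(** Both sides are the same combination of the values of L on the coordinate
    frame, by [frame_expansion]. *)
Lemma tensorial X : smooth_vfield W X -> L X = L (const_field p (X p)).
Proof.
move=> sX; have oW : open W by exact: open_cdom_at.
have Wp : W p by exact: chart_at_dom.
have key Y : smooth_vfield W Y ->
    L Y = \sum_i Y p 0 i *: L (const_field p (unit_vec i)).
  move=> sY; have [F [sF YE Fp]] := frame_expansion sY.
  have sE i : smooth_vfield W (const_field p (unit_vec i)).
    exact: const_field_smooth.
  rewrite (op_local oW Wp LZ sY YE) (op_sum sF sE).
  by apply: eq_bigr => i _; rewrite Fp.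
rewrite (key _ sX) (key _ (const_field_smooth (X p))).
by rewrite const_field_id.
Qed.

End Tensorial.
End VectorFieldCalculus.

(** * Linear and bilinear forms *)
Section LinearForms.
Context {R : nzRingType} {d : nat}.
Variable l : 'rV[R]_d -> R.
Hypothesis l_linear : forall a u v, l (a *: u + v) = a * l u + l v.

Lemma linear_form0 : l 0 = 0.
Proof. by have := l_linear (-1) 0 0; rewrite scaler0 addr0 mulN1r addNr. Qed.

Lemma linear_formD u v : l (u + v) = l u + l v.
Proof. by have := l_linear 1 u v; rewrite scale1r mul1r. Qed.

Lemma linear_formZ a u : l (a *: u) = a * l u.
Proof. by have := l_linear a u 0; rewrite linear_form0 !addr0. Qed.

Lemma linear_form_sum w : l w = \sum_i w 0 i * l (delta_mx 0 i).
Proof.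
rewrite {1}[w]row_sum_delta; elim/big_rec2: _ => [|i y x _ <-].
  exact: linear_form0.
exact: l_linear.
Qed.

End LinearForms.

Section BilinearForms.
Context {R : realType} {d : nat} {M : smoothManifold R d}.
Variables (g : M -> 'M[R]_d) (hg : pseudo_riemannian g).
Implicit Types (p : M) (u v w x : 'rV[R]_d) (a : R).

Lemma bilDl p u v w : bil g p (u + v) w = bil g p u w + bil g p v w.
Proof. by rewrite /bil !mulmxDl mxE. Qed.
Lemma bilDr p u v w : bil g p w (u + v) = bil g p w u + bil g p w v.
Proof. by rewrite /bil linearD mulmxDr mxE. Qed.
Lemma bilZl p a u w : bil g p (a *: u) w = a * bil g p u w.
Proof. by rewrite /bil -!scalemxAl mxE. Qed.
Lemma bilZr p a u w : bil g p w (a *: u) = a * bil g p w u.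
Proof. by rewrite /bil linearZ -scalemxAr mxE. Qed.
Lemma bilNl p u w : bil g p (- u) w = - bil g p u w.
Proof. by rewrite -scaleN1r bilZl mulN1r. Qed.
Lemma bilNr p u w : bil g p w (- u) = - bil g p w u.
Proof. by rewrite -scaleN1r bilZr mulN1r. Qed.
Lemma bil0l p w : bil g p 0 w = 0.
Proof. by rewrite -(scale0r 0) bilZl mul0r. Qed.
Lemma bil0r p w : bil g p w 0 = 0.
Proof. by rewrite -(scale0r 0) bilZr mul0r. Qed.

Definition bilE := (bilDl, bilDr, bilZl, bilZr, bilNl, bilNr, bil0l, bil0r).

Lemma bil_sym p u v : bil g p u v = bil g p v u.
Proof.
case: hg => gT _ _; rewrite /bil.
have <- : (v *m g p *m u^T)^T = u *m g p *m v^T.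
  by rewrite !trmx_mul trmxK gT mulmxA.
by rewrite mxE.
Qed.

(** Since g is nondegenerate, x is the only vector that represents l. *)
Lemma bil_sharp p (x : 'rV[R]_d) (l : 'rV[R]_d -> R) :
  (forall w, l w = bil g p x w) -> sharp g p l = x.
Proof.
case: hg => _ gU _ lx; rewrite /sharp.
have -> : \row_i l (unit_vec i) = x *m g p.
  by apply/rowP => i; rewrite mxE lx /bil /unit_vec trmx_delta -colE mxE.
by rewrite mulmxK.
Qed.

Lemma bil_nondeg p u v : (forall w, bil g p u w = bil g p v w) -> u = v.
Proof. by move=> uv; rewrite -(bil_sharp uv); apply: esym; exact: bil_sharp. Qed.

Lemma sharp_bil p (l : 'rV[R]_d -> R) w :
  (forall a u v, l (a *: u + v) = a * l u + l v) ->
  bil g p (sharp g p l) w = l w.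
Proof.
case: hg => _ gU _ ll; rewrite /bil /sharp mulmxKV// mxE.
by rewrite (linear_form_sum ll w); apply: eq_bigr => i _; rewrite !mxE mulrC.
Qed.

End BilinearForms.

(** The classical octahedron argument: a combination of four instances of the
    Bianchi identity. *)
Lemma pair_symmetry (R : realFieldType) (V : Type) (T : V -> V -> V -> V -> R) :
  (forall u v w x, T u v w x = - T v u w x) ->
  (forall u v w x, T u v w x = - T u v x w) ->
  (forall u v w x, T u v w x + T v w u x + T w u v x = 0) ->
  forall u v w x, T u v w x = T w x u v.
Proof.
move=> s1 sk bi u v w x.
have := bi u v w x; have := bi v w x u; have := bi w x u v; have := bi x u v w.
have := sk v w u x; have := sk w u v x; have := sk w x v u; have := sk x v w u.
have := sk x u w v; have := sk u v x w; have := sk u v w x; have := sk w x u v.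
have := sk u w x v; have := sk v x u w; have := sk v w x u; have := sk x u v w.
have := s1 v x u w; have := s1 v x w u; have := s1 u w v x; have := s1 u w x v.
have := s1 u x v w; have := s1 u x w v; have := s1 w v u x; have := s1 w v x u.
lra.
Qed.

(** * Curvature and Hessian of the Levi-Civita connection *)
Section LeviCivita.
Context {R : realType} {d : nat} {M : smoothManifold R d}.
Variables (g : M -> 'M[R]_d) (hg : pseudo_riemannian g).
Variables (nabla : vfield M -> vfield M -> vfield M).
Hypothesis hn : levi_civita g nabla.
Implicit Types (p q : M) (u v w x : 'rV[R]_d) (W : set M) (f : M -> R).
Implicit Types (X Y Z : vfield M).

Lemma nabla_eql W X X' Y q : open W -> W q -> smooth_vfield W X ->
  smooth_vfield W Y -> (forall r, W r -> X r = X' r) ->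
  nabla X Y q = nabla X' Y q.
Proof.
move=> oW Wq sX sY XX'.
apply: (@op_local _ _ _ _ (fun X => nabla X Y q) W q) => // f Z sf sZ.
exact: (nablaZl hn oW).
Qed.

(** The Leibniz rule for the indicator function of W, whose derivative
    vanishes on W. *)
Lemma nabla_eqr W X Y Y' q : open W -> W q -> smooth_vfield W X ->
  smooth_vfield W Y -> (forall r, W r -> Y r = Y' r) ->
  nabla X Y q = nabla X Y' q.
Proof.
move=> oW Wq sX sY YY'; pose f r : R := (r \in W)%:R.
have f1 r : W r -> f r = 1 by move=> Wr; rewrite /f mem_set.
have sf : smooth_fun W f.
  apply: (@smooth_fun_eq _ _ _ W (fun=> 1)) => //; first by move=> r /f1.
  exact: smooth_fun_cst.
have sY' : smooth_vfield W Y' by apply: smooth_vfield_eq sY.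
have key Z : smooth_vfield W Z -> nabla X (fun r => f r *: Z r) q = nabla X Z q.
  move=> sZ; rewrite (nablaZr hn oW sf sX sZ Wq).
  rewrite (@dfun_eq _ _ _ _ oW f (fun=> 1) q _ Wq) ?dfun_cst ?scale0r ?add0r//.
  by rewrite f1// scale1r.
rewrite -(key _ sY) -(key _ sY'); congr (nabla _ _ _).
apply/funext => r; rewrite /f; case: (boolP (r \in W)) => [/set_mem/YY'->//|_].
by rewrite !scale0r.
Qed.

Lemma nabla0l W Y q : open W -> W q -> smooth_vfield W Y ->
  nabla (fun=> 0) Y q = 0 :> 'rV[R]_d.
Proof.
move=> oW Wq sY; have s0 := smooth_vfield0 (M := M) oW.
have E := nablaZl hn oW (@smooth_fun_cst _ _ M W 0) s0 sY Wq.
rewrite -[RHS](scale0r (nabla (fun=> 0) Y q)) -[RHS]E; congr (nabla _ _ _).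
by apply/funext => r; rewrite scale0r.
Qed.

Lemma nabla0r W X q : open W -> W q -> smooth_vfield W X ->
  nabla X (fun=> 0) q = 0 :> 'rV[R]_d.
Proof.
move=> oW Wq sX; have s0 := smooth_vfield0 (M := M) oW.
have E : nabla X (fun=> 0 *: 0) q =
    dfun (fun=> 0 : R) q (X q) *: 0 + 0 *: nabla X (fun=> 0) q.
  exact (nablaZr hn oW (@smooth_fun_cst _ _ M W 0) sX s0 Wq).
by move: E; rewrite !scaler0 scale0r addr0.
Qed.

(** The curvature R(U, V) Z when U and V commute. *)
Definition cov2_commutator U V Z p : 'rV[R]_d :=
  nabla U (nabla V Z) p - nabla V (nabla U Z) p.

Section Commutator.
Variables (W : set M) (p : M) (oW : open W) (Wp : W p).
Let sN X Y : smooth_vfield W X -> smooth_vfield W Y ->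
  smooth_vfield W (nabla X Y).
Proof. exact: (nabla_smooth hn oW). Qed.
Variables U V : vfield M.
Hypotheses (sU : smooth_vfield W U) (sV : smooth_vfield W V).

Lemma nabla2D U' V' X Y : smooth_vfield W U' -> smooth_vfield W V' ->
  smooth_vfield W X -> smooth_vfield W Y ->
  nabla U' (nabla V' (fun q => X q + Y q)) p =
  nabla U' (nabla V' X) p + nabla U' (nabla V' Y) p.
Proof.
move=> sU' sV' sX sY; have sXY := smooth_vfieldD oW sX sY.
rewrite -(nablaDr hn oW sU' (sN sV' sX) (sN sV' sY) Wp).
apply: (nabla_eqr oW Wp sU' (sN sV' sXY)) => r Wr.
exact: (nablaDr hn oW sV' sX sY Wr).
Qed.

Lemma cov2_commutatorD X Y : smooth_vfield W X -> smooth_vfield W Y ->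
  cov2_commutator U V (fun q => X q + Y q) p =
  cov2_commutator U V X p + cov2_commutator U V Y p.
Proof.
move=> sX sY; rewrite /cov2_commutator.
rewrite (nabla2D sU sV sX sY) (nabla2D sV sU sX sY).
by rewrite opprD addrACA.
Qed.

Lemma nabla2Z U' V' f X : smooth_vfield W U' -> smooth_vfield W V' ->
  smooth_fun W f -> smooth_fun W (fun q => dfun f q (V' q)) ->
  smooth_vfield W X ->
  nabla U' (nabla V' (fun q => f q *: X q)) p =
  dfun (fun q => dfun f q (V' q)) p (U' p) *: X p
  + dfun f p (V' p) *: nabla U' X p
  + (dfun f p (U' p) *: nabla V' X p + f p *: nabla U' (nabla V' X) p).
Proof.
move=> sU' sV' sf sD sX; have sfX := smooth_vfieldZ oW sf sX.
have s1 := smooth_vfieldZ oW sD sX.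
have s2 := smooth_vfieldZ oW sf (sN sV' sX).
rewrite -(nablaZr hn oW sD sU' sX Wp) -(nablaZr hn oW sf sU' (sN sV' sX) Wp).
rewrite -(nablaDr hn oW sU' s1 s2 Wp).
apply: (nabla_eqr oW Wp sU' (sN sV' sfX)) => r Wr.
exact: (nablaZr hn oW sf sV' sX Wr).
Qed.

Lemma cov2_commutatorZ f X :
  smooth_fun W f -> smooth_fun W (fun q => dfun f q (V q)) ->
  smooth_fun W (fun q => dfun f q (U q)) -> smooth_vfield W X ->
  dfun (fun q => dfun f q (V q)) p (U p) =
  dfun (fun q => dfun f q (U q)) p (V p) ->
  cov2_commutator U V (fun q => f q *: X q) p = f p *: cov2_commutator U V X p.
Proof.
move=> sf sV' sU' sX E; rewrite /cov2_commutator (nabla2Z sU sV sf sV' sX).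
rewrite (nabla2Z sV sU sf sU' sX) E scalerBr.
by apply/rowP => j; rewrite !mxE; ring.
Qed.

Lemma cov2_commutator_bianchi Z : smooth_vfield W Z ->
  (forall q, W q -> nabla U V q = nabla V U q) ->
  (forall q, W q -> nabla U Z q = nabla Z U q) ->
  (forall q, W q -> nabla Z V q = nabla V Z q) ->
  cov2_commutator U V Z p + cov2_commutator V Z U p
  + cov2_commutator Z U V p = 0.
Proof.
move=> sZ UV UZ ZV; rewrite /cov2_commutator.
rewrite (nabla_eqr oW Wp sZ (sN sU sV) UV) (nabla_eqr oW Wp sV (sN sU sZ) UZ).
rewrite (nabla_eqr oW Wp sU (sN sZ sV) ZV).
by apply/rowP => j; rewrite !mxE; ring.
Qed.

Let sb X Y : smooth_vfield W X -> smooth_vfield W Y ->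
    smooth_fun W (fun q => bil g q (X q) (Y q)).
Proof. by case: hg => _ _; exact. Qed.

Lemma nabla2_metric U' V' X Y : smooth_vfield W U' -> smooth_vfield W V' ->
  smooth_vfield W X -> smooth_vfield W Y ->
  dfun (fun q => dfun (fun r => bil g r (X r) (Y r)) q (V' q)) p (U' p) =
  bil g p (nabla U' (nabla V' X) p) (Y p)
  + bil g p (nabla V' X p) (nabla U' Y p)
  + (bil g p (nabla U' X p) (nabla V' Y p)
     + bil g p (X p) (nabla U' (nabla V' Y) p)).
Proof.
move=> sU' sV' sX sY.
have E q : W q -> dfun (fun r => bil g r (X r) (Y r)) q (V' q) =
   bil g q (nabla V' X q) (Y q) + bil g q (X q) (nabla V' Y q).
  exact: (nabla_metric hn oW sV' sX sY).
rewrite (dfun_eq oW _ Wp E).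
rewrite (dfunD _ (sb (sN sV' sX) sY) (sb sX (sN sV' sY)) Wp).
rewrite (nabla_metric hn oW sU' (sN sV' sX) sY Wp).
by rewrite (nabla_metric hn oW sU' sX (sN sV' sY) Wp).
Qed.

Lemma cov2_commutator_metric X Y : smooth_vfield W X -> smooth_vfield W Y ->
  dfun (fun q => dfun (fun r => bil g r (X r) (Y r)) q (V q)) p (U p) =
  dfun (fun q => dfun (fun r => bil g r (X r) (Y r)) q (U q)) p (V p) ->
  bil g p (cov2_commutator U V X p) (Y p)
  + bil g p (X p) (cov2_commutator U V Y p) = 0.
Proof.
move=> sX sY; rewrite (nabla2_metric sU sV sX sY) (nabla2_metric sV sU sX sY).
by move=> E; rewrite /cov2_commutator !bilE; move: E; lra.
Qed.

End Commutator.

Section AtPoint.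
Variable p : M.
Local Notation W := (cdom (chart_at p)).
Local Notation C := (const_field p).
Let oW : open W. Proof. exact: open_cdom_at. Qed.
Let Wp : W p. Proof. exact: chart_at_dom. Qed.
Let sC u : smooth_vfield W (C u). Proof. exact: const_field_smooth. Qed.
Let sN X Y : smooth_vfield W X -> smooth_vfield W Y ->
  smooth_vfield W (nabla X Y).
Proof. exact: (nabla_smooth hn oW). Qed.
Let Cp u : C u p = u. Proof. exact: const_field_id. Qed.

Lemma nabla_const_sym u v q : W q -> nabla (C u) (C v) q = nabla (C v) (C u) q.
Proof.
move=> Wq; apply/eqP; rewrite -subr_eq0.
by rewrite (nabla_torsion_free hn oW (sC u) (sC v) Wq) bracket_const.
Qed.

Lemma curvature_const u v Z q : smooth_vfield W Z -> W q ->
  curvature nabla (C u) (C v) Z q = cov2_commutator (C u) (C v) Z q.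
Proof.
move=> sZ Wq; rewrite /curvature.
have E r : W r -> 0 = bracket (C u) (C v) r by move=> Wr; rewrite bracket_const.
rewrite -(nabla_eql oW Wq (smooth_vfield0 oW) sZ E).
by rewrite (nabla0l oW Wq sZ) subr0.
Qed.

(** The fields u, v are kept constant, as in the definition of [Riem], but the
    third field may be any extension of its value; this allows Z = xi. *)
Lemma Riem_field u v Z : smooth_vfield W Z ->
  Riem nabla p u v (Z p) = cov2_commutator (C u) (C v) Z p.
Proof.
move=> sZ; rewrite -(curvature_const u v sZ Wp) /Riem.
rewrite (curvature_const u v (sC _) Wp) (curvature_const u v sZ Wp).
apply: esym.
apply: (tensorial (p := p) (L := fun Z => cov2_commutator (C u) (C v) Z p)) sZ.
- by move=> X Y; exact: (cov2_commutatorD oW Wp).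
- move=> f X sf sX.
  have E := dfun_const_sym u v oW (fun r h => h) sf Wp.
  exact: (cov2_commutatorZ oW Wp (sC u) (sC v) sf (smooth_dfun sf (sC v))
    (smooth_dfun sf (sC u)) sX E).
Qed.

Lemma Riem_const u v w :
  Riem nabla p u v w = cov2_commutator (C u) (C v) (C w) p.
Proof. by rewrite -(Riem_field u v (sC w)) Cp. Qed.

Lemma Riem_skew u v w : Riem nabla p u v w = - Riem nabla p v u w.
Proof.
by rewrite (Riem_const u v w) (Riem_const v u w) /cov2_commutator opprB.
Qed.

Lemma Riem_bianchi u v w :
  Riem nabla p u v w + Riem nabla p v w u + Riem nabla p w u v = 0.
Proof.
rewrite (Riem_const u v w) (Riem_const v w u) (Riem_const w u v).
apply: (cov2_commutator_bianchi oW Wp (sC u) (sC v) (sC w)) => q Wq;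
  exact: nabla_const_sym.
Qed.

(** Expand the two mixed second derivatives of g(w, x), which agree. *)
Lemma Riem_metric u v w x :
  bil g p (Riem nabla p u v w) x + bil g p w (Riem nabla p u v x) = 0.
Proof.
have sb : smooth_fun W (fun q => bil g q (C w q) (C x q)).
  by case: hg => _ _ sb; exact (sb _ _ _ oW (sC w) (sC x)).
have E := cov2_commutator_metric oW Wp (sC u) (sC v) (sC w) (sC x)
  (dfun_const_sym u v oW (fun r h => h) sb Wp).
by rewrite !Cp in E; rewrite (Riem_const u v w) (Riem_const u v x).
Qed.

Lemma Riem_skew34 u v w x :
  bil g p (Riem nabla p u v w) x = - bil g p (Riem nabla p u v x) w.
Proof.
have /eqP := Riem_metric u v w x; rewrite addr_eq0 => /eqP E.
by apply: (etrans E); congr (- _); exact: bil_sym.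
Qed.

Lemma Riem_pair u v w x :
  bil g p (Riem nabla p u v w) x = bil g p (Riem nabla p w x u) v.
Proof.
apply: (@pair_symmetry _ _ (fun a b c e => bil g p (Riem nabla p a b c) e)).
- by move=> a b c e; rewrite (Riem_skew a b c) bilNl.
- exact: Riem_skew34.
- by move=> a b c e; rewrite -bilDl -bilDl Riem_bianchi bil0l.
Qed.

(** The Hessian of f, with u extended by a constant field. *)
Definition hess f u (Y : vfield M) : R :=
  dfun (fun q => dfun f q (Y q)) p u - dfun f p (nabla (C u) Y p).

Lemma dfunZr f q (a : R) x : smooth_fun W f -> W q ->
  dfun f q (a *: x) = a * dfun f q x.
Proof.
move=> sf Wq.
exact: (linear_formZ (l := dfun f q) (fun b u v => dfun_linear b u v sf Wq)).
Qed.

Lemma dfunDr f q x y : smooth_fun W f -> W q ->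
  dfun f q (x + y) = dfun f q x + dfun f q y.
Proof.
move=> sf Wq.
exact: (linear_formD (l := dfun f q) (fun b u v => dfun_linear b u v sf Wq)).
Qed.

Lemma hessD f u X Y : smooth_fun W f -> smooth_vfield W X ->
  smooth_vfield W Y ->
  hess f u (fun q => X q + Y q) = hess f u X + hess f u Y.
Proof.
move=> sf sX sY; rewrite /hess.
have E q : W q -> dfun f q (X q + Y q) = dfun f q (X q) + dfun f q (Y q).
  exact: dfunDr.
rewrite (dfun_eq oW _ Wp E) (dfunD _ (smooth_dfun sf sX) (smooth_dfun sf sY) Wp).
rewrite (nablaDr hn oW (sC u) sX sY Wp).
rewrite (dfunDr (nabla (C u) X p) (nabla (C u) Y p) sf Wp).
by rewrite opprD addrACA.
Qed.

Lemma hessZ f u h X : smooth_fun W f -> smooth_fun W h -> smooth_vfield W X ->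
  hess f u (fun q => h q *: X q) = h p * hess f u X.
Proof.
move=> sf sh sX; rewrite /hess.
have E q : W q -> dfun f q (h q *: X q) = h q * dfun f q (X q).
  exact: dfunZr.
rewrite (dfun_eq oW _ Wp E) (dfunM _ sh (smooth_dfun sf sX) Wp).
rewrite (nablaZr hn oW sh (sC u) sX Wp) (Cp u).
rewrite (dfunDr (dfun h p u *: X p) (h p *: nabla (C u) X p) sf Wp).
rewrite (dfunZr (dfun h p u) (X p) sf Wp) (dfunZr (h p) (nabla (C u) X p) sf Wp).
move: (dfun (fun q => dfun f q (X q)) p u) (dfun f p (nabla (C u) X p)) => a b.
by ring.
Qed.

Lemma hess_field f u Y : smooth_fun W f -> smooth_vfield W Y ->
  hess f u Y = hess f u (C (Y p)).
Proof.
move=> sf sY.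
apply: (@tensorial _ _ _ p R^o (hess f u)) sY.
- by move=> X Y'; exact: hessD.
- by move=> h X; exact: hessZ.
Qed.

(** The connection is torsion free and constant fields commute. *)
Lemma hess_sym f u v : smooth_fun W f -> hess f u (C v) = hess f v (C u).
Proof.
move=> sf; have E1 := nabla_const_sym u v Wp.
have E2 := dfun_const_sym u v oW (fun r h => h) sf Wp.
rewrite (Cp u) (Cp v) in E2.
exact (f_equal2 (fun a b => a - dfun f p b) E2 E1).
Qed.

End AtPoint.
End LeviCivita.

(** * Pointwise algebra of the paracontact structure *)
Section Trace.
Context {R : realFieldType} {d : nat}.
Local Notation V := 'rV[R]_d.
Local Notation tr f := (\tr (lin1_mx f)).
Implicit Types (f k : V -> V) (u v w : V) (a : R).

Lemma tr_lin1E f : tr f = \sum_i f (delta_mx 0 i) 0 i.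
Proof. by apply: eq_bigr => i _; rewrite mxE. Qed.

Lemma tr_lin1D f k : tr (fun u => f u + k u) = tr f + tr k.
Proof.
by rewrite !tr_lin1E -big_split; apply: eq_bigr => i _; rewrite mxE.
Qed.

Lemma tr_lin1Z a f : tr (fun u => a *: f u) = a * tr f.
Proof. by rewrite !tr_lin1E mulr_sumr; apply: eq_bigr => i _; rewrite mxE. Qed.

Lemma tr_lin1_id : tr (fun u => u) = d%:R.
Proof.
rewrite tr_lin1E (eq_bigr (fun=> 1)) ?sumr_const ?card_ord// => i _.
by rewrite mxE !eqxx.
Qed.

Lemma tr_lin1_rank1 (l : V -> R) v :
  (forall a u w, l (a *: u + w) = a * l u + l w) ->
  tr (fun u => l u *: v) = l v.
Proof.
move=> ll; rewrite tr_lin1E (linear_form_sum ll v).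
by apply: eq_bigr => i _; rewrite mxE mulrC.
Qed.

End Trace.

Lemma rank1_collinear (R : fieldType) (m d : nat) (A : 'M[R]_(m, d)) (u v : 'rV[R]_d)
    (l : 'rV[R]_d -> R) : (forall a u w, l (a *: u + w) = a * l u + l w) ->
  \rank A = 1%N -> (u <= A)%MS -> (v <= A)%MS -> l u *: v = l v *: u.
Proof.
move=> ll rA uA vA.
have l0 := linear_form0 ll.
have [->|u0] := eqVneq u 0; first by rewrite l0 scale0r scaler0.
have Au : (A <= u)%MS by rewrite -(mxrank_leqif_sup uA) rA rank_rV u0.
have /sub_rVP[c ->] := submx_trans vA Au.
by rewrite (linear_formZ ll) !scalerA mulrC.
Qed.

(** This section concerns a single tangent space: g is the metric, F = phi,
    h = eta and xi1 = xi. *)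
Section ParacontactAlgebra.
Context {R : realFieldType} {d : nat}.
Local Notation V := 'rV[R]_d.
Local Notation tr f := (\tr (lin1_mx f)).
Variable g : V -> V -> R.
Hypotheses (gDl : forall u v w, g (u + v) w = g u w + g v w)
  (gZl : forall a u w, g (a *: u) w = a * g u w)
  (g_sym : forall u v, g u v = g v u)
  (g_nondeg : forall u v, (forall w, g u w = g v w) -> u = v).
Variables (Phi : 'M[R]_d) (eta1 : 'cV[R]_d) (xi1 : V).
Local Notation F v := (v *m Phi).
Local Notation h v := ((v *m eta1) 0 0).
Hypotheses (F_xi : F xi1 = 0) (h_F0 : Phi *m eta1 = 0) (h_xi : h xi1 = 1)
  (FF : forall v, F (F v) = v - h v *: xi1)
  (g_F : forall u v, g (F u) (F v) = - g u v + h u * h v).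
Implicit Types (u v w x y z : V) (a b : V -> R) (c : R).

Let gDr u v w : g w (u + v) = g w u + g w v.
Proof. by rewrite g_sym gDl !(g_sym _ w). Qed.
Let gZr c u w : g w (c *: u) = c * g w u.
Proof. by rewrite g_sym gZl !(g_sym _ w). Qed.
Let gNl u w : g (- u) w = - g u w.
Proof. by rewrite -scaleN1r gZl mulN1r. Qed.
Let gNr u w : g w (- u) = - g w u.
Proof. by rewrite -scaleN1r gZr mulN1r. Qed.
Let g0l w : g 0 w = 0.
Proof. by rewrite -(scale0r 0) gZl mul0r. Qed.
Let g0r w : g w 0 = 0.
Proof. by rewrite g_sym g0l. Qed.
Let gE := (gDl, gDr, gZl, gZr, gNl, gNr, g0l, g0r).

Lemma paracontact_eta_phi v : h (F v) = 0.
Proof. by rewrite -mulmxA h_F0 mulmx0 mxE. Qed.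
Let hD u v : h (u + v) = h u + h v. Proof. by rewrite mulmxDl mxE. Qed.
Let hZ c v : h (c *: v) = c * h v. Proof. by rewrite -scalemxAl mxE. Qed.

Lemma paracontact_form_xi u : g u xi1 = h u.
Proof.
have := g_F u xi1; rewrite F_xi h_xi -(scale0r 0) gZr mul0r mulr1.
by move/esym/eqP; rewrite addrC subr_eq0 => /eqP.
Qed.

Lemma paracontact_phi_skew u v : g (F u) v = - g u (F v).
Proof.
have := g_F u (F v); rewrite FF paracontact_eta_phi mulr0 addr0 !gE.
rewrite paracontact_form_xi paracontact_eta_phi mulr0 subr0.
by move=> ->.
Qed.

Lemma paracontact_phi3 v : F (F (F v)) = F v.
Proof. by rewrite FF paracontact_eta_phi scale0r subr0. Qed.

(** phi^2 is the identity minus the rank one operator eta (x) xi. *)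
Lemma trace_phi2 : tr (fun y => F (F y)) = d%:R - 1.
Proof.
have -> : (fun y => F (F y)) = (fun y => y + (-1) *: (h y *: xi1)).
  by apply/funext => y; rewrite FF scaleN1r.
rewrite tr_lin1D tr_lin1Z tr_lin1_id (tr_lin1_rank1 (l := fun y => h y)) ?h_xi.
  by rewrite mulN1r.
by move=> c u w; rewrite hD hZ.
Qed.

Lemma paracontact_phi_neq0 : (1 < d)%N -> exists y w, g (F y) w != 0.
Proof.
move=> d1; apply: contrapT => /forallNP H.
have F0 y : F y = 0.
  apply: g_nondeg => w; rewrite -(scale0r 0) gZl mul0r.
  by apply/eqP/negPn/negP => yw; apply: (H y); exists w.
have := trace_phi2; rewrite tr_lin1E big1 => [|i _]; last by rewrite !F0 mxE.
move/esym/eqP; rewrite subr_eq0 => /eqP; rewrite -[1]/(1%:R) => /eqP.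
by rewrite eqr_nat => /eqP d1'; move: d1; rewrite d1'.
Qed.

(** Here a = d alpha, b = d beta, and A is the gradient of alpha. *)
Variables (a b : V -> R) (al be : R) (A : V) (n : nat).
Hypotheses (hd : d = (2 * n).+1) (hn : (1 <= n)%N).
Hypotheses (aL : forall c u w, a (c *: u + w) = c * a u + a w)
  (bL : forall c u w, b (c *: u + w) = c * b u + b w)
  (aA : forall u, a u = g A u)
  (ba : forall v, (2 * n%:R - 1) * b v = a (F v)).
Let kap := al ^+ 2 + be ^+ 2.

(** The value of R(u, v) xi, see [Riem_xi]. *)
Definition xi_curvature_formula u v : V :=
  - a u *: F v + a v *: F u - b u *: F (F v) + b v *: F (F u)
  - kap *: (h v *: u - h u *: v)
  - (2 * al * be) *: (h v *: F u - h u *: F v).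

Local Notation Rx := xi_curvature_formula.
Hypotheses (curv_sym : forall y w, g (Rx xi1 y) w = g (Rx xi1 w) y)
  (curv_cyc : forall u v w, g (Rx u v) w + g (Rx v w) u + g (Rx w u) v = 0).

Let a0 : a 0 = 0.
Proof. exact: linear_form0 aL. Qed.
Let aD u v : a (u + v) = a u + a v.
Proof. exact: linear_formD aL u v. Qed.
Let aZ c v : a (c *: v) = c * a v.
Proof. exact: linear_formZ aL c v. Qed.
Let m_neq0 : 2 * n%:R - 1 != 0 :> R.
Proof.
have : (1 : R) <= n%:R by rewrite ler1n.
by move=> n1; apply: lt0r_neq0; lra.
Qed.

Let dR : d%:R = 2 * n%:R + 1 :> R.
Proof. by rewrite hd -addn1 natrD natrM. Qed.

Lemma dbeta_on_xi : b xi1 = 0.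
Proof. by apply: (mulfI m_neq0); rewrite ba F_xi a0 mulr0. Qed.

(** The antisymmetric part of the form g(R(xi, y) xi, w) in y and w is
    (2 alpha beta - a(xi)) g(phi y, w), and g(phi y, w) is not identically
    zero. *)
Lemma dalpha_on_xi : a xi1 = 2 * al * be.
Proof.
have d1 : (1 < d)%N by rewrite hd ltnS muln_gt0.
have [y [w yw]] := paracontact_phi_neq0 d1.
have := curv_sym y w; rewrite /xi_curvature_formula F_xi mul0mx h_xi.
rewrite !scaler0 !addr0 dbeta_on_xi scale0r.
rewrite !FF !gE (g_sym xi1 w) (g_sym xi1 y) !paracontact_form_xi (g_sym w y).
have -> : g (F w) y = - g (F y) w by rewrite paracontact_phi_skew g_sym.
move=> E; apply: (mulIf yw).
move: E; move: (g (F y) w) (g y w) (h y) (h w) (a xi1) => p q r s c; nra.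
Qed.

(** On ker eta the Bianchi identity says that the cyclic sum of
    a(x) g(phi y, w) is zero.  As w is arbitrary, this is the vanishing of a
    vector that depends linearly on y; after an application of phi, its trace
    in y is (2n - 2) a(phi x). *)
Lemma dalpha_horizontal x : (2 * n%:R - 2) * a (F x) = 0.
Proof.
have qS u v : g (F u) v = - g (F v) u by rewrite paracontact_phi_skew g_sym.
have cyc y : a (F x) *: F y - a (F y) *: F x - g (F x) y *: F A = 0.
  apply: g_nondeg => w; rewrite !gE (paracontact_phi_skew A) -aA.
  have := curv_cyc (F x) (F y) (F w); rewrite /xi_curvature_formula.
  rewrite !paracontact_phi3 !paracontact_eta_phi !scale0r !gE.
  rewrite !g_F !paracontact_eta_phi !mul0r !addr0 (qS w x) (qS w y) (qS y x).
  rewrite (g_sym w x) (g_sym w y) (g_sym y x).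
  move: (g (F x) y) (g (F x) w) (g (F y) w) (a (F x)) (a (F y)) (a (F w)).
  by move=> p q r s t k; lra.
have cycF y : a (F x) *: F (F y) + ((-1) *: (a (F y) *: F (F x))
    + (-1) *: (g (F x) y *: F (F A))) = 0.
  have := congr1 (fun v => F v) (cyc y).
  by rewrite mul0mx !mulmxBl -!scalemxAl !scaleN1r addrA.
have : tr (fun y => a (F x) *: F (F y) + ((-1) *: (a (F y) *: F (F x))
    + (-1) *: (g (F x) y *: F (F A)))) = 0.
  by rewrite tr_lin1E big1// => i _; rewrite cycF mxE.
rewrite tr_lin1D tr_lin1Z trace_phi2 tr_lin1D !tr_lin1Z.
rewrite (tr_lin1_rank1 (l := fun y => a (F y))); last first.
  by move=> c u w; rewrite mulmxDl -scalemxAl aL.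
rewrite (tr_lin1_rank1 (l := fun y => g (F x) y)); last first.
  by move=> c u w; rewrite gDr gZr.
rewrite paracontact_phi3 (g_sym (F x)) -(opprK (g _ _)) -paracontact_phi_skew.
rewrite paracontact_phi3 paracontact_phi_skew -aA dR.
by lra.
Qed.

Hypotheses
  (rank_p : \rank (kermx eta1 :&: eigenspace Phi 1)%MS = n)
  (rank_m : \rank (kermx eta1 :&: eigenspace Phi (-1))%MS = n).

Lemma a_horizontal u : a u = a (F (F u)) + 2 * al * be * h u.
Proof. by rewrite FF -scaleNr aD aZ dalpha_on_xi; lra. Qed.

(** The terms in a and b cancel.  If n > 1 they vanish separately on ker eta,
    by [dalpha_horizontal].  If n = 1, decompose phi u and phi v along the
    eigenlines of phi: the contribution of each eigenvalue is a multiple of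
    a(v') u' - a(u') v', where u' and v' lie on one line. *)
Lemma xi_curvature_formulaE u v : Rx u v = - kap *: (h v *: u - h u *: v).
Proof.
suff T : - a u *: F v + a v *: F u - b u *: F (F v) + b v *: F (F u)
    - (2 * al * be) *: (h v *: F u - h u *: F v) = 0.
  by rewrite /xi_curvature_formula addrAC T sub0r scaleNr.
have b_hor x : b x = b (F (F x)).
  by rewrite FF -scaleNr addrC bL dbeta_on_xi mulr0 add0r.
rewrite (a_horizontal u) (a_horizontal v) (b_hor u) (b_hor v).
have [n1|n1] := eqVneq n 1%N; last first.
  have n2 : 2 * n%:R - 2 != 0 :> R.
    have : (2 : R) <= n%:R by rewrite (ler_nat _ 2) ltn_neqAle eq_sym n1.
    by move=> H; apply: lt0r_neq0; lra.
  have aF x : a (F x) = 0 by apply: (mulfI n2); rewrite dalpha_horizontal mulr0.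
  have bF x : b (F x) = 0 by apply: (mulfI m_neq0); rewrite ba aF mulr0.
  rewrite !aF !bF !scale0r.
  by apply/rowP => j; rewrite !mxE; ring.
have ba1 x : b x = a (F x) by rewrite -ba n1; lra.
rewrite !ba1 !paracontact_phi3.
(* Twice the component of F x on the eigenline for e, with e = 1 or -1. *)
have line (e : R) x : e * e = 1 ->
    ((F x + e *: F (F x))%R <= kermx eta1 :&: eigenspace Phi e)%MS.
  move=> ee; rewrite sub_capmx; apply/andP; split.
    apply/sub_kermxP; rewrite mulmxDl -scalemxAl -!mulmxA h_F0 !mulmx0 scaler0.
    exact: addr0.
  apply/eigenspaceP; rewrite mulmxDl -scalemxAl paracontact_phi3 scalerDr scalerA ee scale1r.
  by rewrite addrC.
have e1 : (1 : R) * 1 = 1 by rewrite mulr1.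
have em1 : (-1 : R) * -1 = 1 by rewrite mulrNN mulr1.
have Ep := rank1_collinear aL (etrans rank_p n1) (line _ u e1) (line _ v e1).
have Em := rank1_collinear aL (etrans rank_m n1) (line _ u em1) (line _ v em1).
move: Ep Em; rewrite !aD !aZ.
move: (a (F (F u))) (a (F u)) (a (F (F v))) (a (F v)) => a1 a2 a3 a4.
move: (F (F u)) (F u) (F (F v)) (F v) (h u) (h v) => u2 u1 v2 v1 hu hv.
move=> /rowP Ep /rowP Em; apply/rowP => j; move: (Ep j) (Em j).
by rewrite !mxE; lra.
Qed.

End ParacontactAlgebra.

(** In the next section Rm is the Riemann tensor at a point where xi belongs
    to the nullity distribution, R(u, v) xi = - kappa (eta(v) u - eta(u) v). *)
Section XiCurvature.
Context {R : realFieldType} {d : nat}.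
Local Notation V := 'rV[R]_d.
Local Notation tr f := (\tr (lin1_mx f)).
Variable g : V -> V -> R.
Hypotheses (gDl : forall u v w, g (u + v) w = g u w + g v w)
  (gZl : forall a u w, g (a *: u) w = a * g u w)
  (g_sym : forall u v, g u v = g v u)
  (g_nondeg : forall u v, (forall w, g u w = g v w) -> u = v).
Variables (h : V -> R) (xi1 : V).
Hypotheses (g_xi : forall u, g u xi1 = h u) (h_xi : h xi1 = 1).
Variables (Rm : V -> V -> V -> V) (kap : R) (n : nat).
Hypotheses (hd : d = (2 * n).+1)
  (Rm_skew : forall u v w x, g (Rm u v w) x = - g (Rm u v x) w)
  (Rm_pair : forall u v w x, g (Rm u v w) x = g (Rm w x u) v)
  (Rm_xi : forall u v, Rm u v xi1 = - kap *: (h v *: u - h u *: v)).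
Implicit Types (u v w x y z : V) (c : R).
Local Notation ric v w := (tr (fun u => Rm u v w)).

Let gDr u v w : g w (u + v) = g w u + g w v.
Proof. by rewrite g_sym gDl !(g_sym _ w). Qed.
Let gZr c u w : g w (c *: u) = c * g w u.
Proof. by rewrite g_sym gZl !(g_sym _ w). Qed.
Let gNl u w : g (- u) w = - g u w.
Proof. by rewrite -scaleN1r gZl mulN1r. Qed.
Let gE := (gDl, gZl, gNl).
Let hL c u w : h (c *: u + w) = c * h u + h w.
Proof. by rewrite -!g_xi gDl gZl. Qed.
Let gL y c u w : g y (c *: u + w) = c * g y u + g y w.
Proof. by rewrite gDr gZr. Qed.
Let dR : d%:R = 2 * n%:R + 1 :> R.
Proof. by rewrite hd -addn1 natrD natrM. Qed.

(** Pair symmetry moves xi to the third slot. *)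
Lemma nullity_curvature_xi u w : Rm u xi1 w = kap *: (g w u *: xi1 - h w *: u).
Proof.
apply: g_nondeg => z; rewrite Rm_pair Rm_skew Rm_xi !gE.
by rewrite (g_sym xi1) g_xi (g_sym z u); lra.
Qed.

Lemma nullity_xi_curvature y z w :
  g (Rm xi1 y z) w = kap * (h z * g y w - g y z * h w).
Proof.
by rewrite Rm_pair Rm_xi !gE (g_sym z y) (g_sym w y); lra.
Qed.

Lemma nullity_ric w : ric xi1 w = - (2 * n%:R) * kap * h w.
Proof.
have -> : (fun u => Rm u xi1 w) =
    (fun u => kap *: (g w u *: xi1 + (- h w) *: u)).
  by apply/funext => u; rewrite nullity_curvature_xi scaleNr.
by rewrite tr_lin1Z tr_lin1D !tr_lin1Z tr_lin1_id tr_lin1_rank1// dR g_xi; lra.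
Qed.

(** By pair symmetry g(Rm x v w, z) = g(Rm w z x, v), which is linear in v. *)
Lemma curvature_ric_linear c u v w : ric (c *: u + v) w = c * ric u w + ric v w.
Proof.
rewrite -tr_lin1Z -tr_lin1D; congr (tr _); apply/funext => x.
by apply: g_nondeg => z; rewrite !gE !(Rm_pair x) gDr gZr.
Qed.

Lemma curvature_ric0 w : ric 0 w = 0.
Proof.
exact: (linear_form0 (l := fun v => ric v w) (fun a u v => curvature_ric_linear a u v w)).
Qed.

(** Take z = xi and substitute Ric(xi, .) = - 2n kappa eta. *)
Lemma nullity_commuting_ric c (B : V -> V -> V) :
  (forall y z, B y z = c *: (h z *: y - g y z *: xi1)) ->
  (forall y z v, ric (B y z) v + ric z (B y v) = 0) ->
  c = 0 \/ forall u v, ric u v = - (2 * n%:R) * kap * g u v.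
Proof.
move=> BE BR; have [->|c0] := eqVneq c 0; [by left|right=> y v].
have ricZ a u w : ric (a *: u) w = a * ric u w.
  exact: (linear_formZ (l := fun v => ric v w)
    (fun a u v => curvature_ric_linear a u v w)).
have := BR y xi1 v; rewrite !BE h_xi scale1r g_xi.
rewrite ricZ -scaleNr (addrC y) curvature_ric_linear !nullity_ric.
rewrite -[h (c *: _)]g_xi !gE !g_xi h_xi => E.
by apply: (mulfI c0); move: E; move: (ric y v) => r; lra.
Qed.

Lemma bianchi_cyclic_sum x u v w :
  (forall u v w, Rm u v w + Rm v w u + Rm w u v = 0) ->
  g (Rm u v x) w + g (Rm v w x) u + g (Rm w u x) v = 0.
Proof.
move=> bianchi; rewrite (Rm_skew _ _ x w) (Rm_skew _ _ x u) (Rm_skew _ _ x v).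
by rewrite -!opprD -!gDl bianchi -(scale0r 0) gZl mul0r oppr0.
Qed.

End XiCurvature.

(** * Geometry of trans-para-Sasakian manifolds *)
Section TransParaSasakianGeometry.
Context {R : realType} {n : nat} {M : smoothManifold R (2 * n).+1}.
Variables (S : paracontact M) (nabla : vfield M -> vfield M -> vfield M).
Hypothesis hnabla : levi_civita (metric S) nabla.
Variables (al be : M -> R).
Hypothesis hS : trans_para_sasakian S nabla al be.
Implicit Types (p q r : M) (W : set M) (X Y Z U V : vfield M).
Local Notation T := 'rV[R]_((2 * n).+1).
Implicit Types (u v w x : T).
Local Notation g := (bil (metric S)).
Local Notation xi := (xi S).
Local Notation F q v := (v *m phi S q).
Local Notation h := (Defs.eta S).

Let hg : pseudo_riemannian (metric S). Proof. exact: metric_pseudo_riemannian. Qed.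
Let F_xi q : F q (xi q) = 0. Proof. exact: phi_xi. Qed.
Let h_F0 q : phi S q *m eta_mx S q = 0. Proof. exact: eta_phi. Qed.
Let h_xi q : (xi q *m eta_mx S q) 0 0 = 1. Proof. exact: eta_xi. Qed.
Let FF q v : F q (F q v) = v - h q v *: xi q. Proof. exact: phi_phi. Qed.
Let g_F q u v : g q (F q u) (F q v) = - g q u v + h q u * h q v.
Proof. exact: metric_phi. Qed.
Let gD q := bilDl (metric S) q.
Let gZ q := bilZl (metric S) q.
Let gC q := bil_sym hg q.
Let gnd q := bil_nondeg hg (p := q).

Lemma metric_xi q u : g q u (xi q) = h q u.
Proof. exact: (paracontact_form_xi (gZ q) (gC q) (F_xi q) (h_xi q) (g_F q)). Qed.

Lemma eta_phi0 q v : h q (F q v) = 0.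
Proof. exact: (paracontact_eta_phi (h_F0 q)). Qed.

Lemma phi_phi_phi q v : F q (F q (F q v)) = F q v.
Proof. exact: (paracontact_phi3 (h_F0 q) (FF q)). Qed.

Lemma metric_phi_skew q u v : g q (F q u) v = - g q u (F q v).
Proof.
exact: (paracontact_phi_skew (gD q) (gZ q) (gC q) (F_xi q) (h_F0 q) (h_xi q) (FF q) (g_F q)).
Qed.

Lemma xi_smooth_on W : smooth_vfield W xi.
Proof. exact: (smooth_vfield_sub (@subsetT _ W) (xi_smooth S)). Qed.

Lemma al_smooth W : smooth_fun W al.
Proof. by case: hS => s _ _; exact (smooth_fun_sub (@subsetT _ W) s). Qed.

Lemma be_smooth W : smooth_fun W be.
Proof. by case: hS => _ s _; exact (smooth_fun_sub (@subsetT _ W) s). Qed.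

(** The value of (nabla_u phi) v prescribed by the structure equation. *)
Definition dphi q u v : T :=
  al q *: (- g q u v *: xi q + h q v *: u)
  + be q *: (g q u (F q v) *: xi q + h q v *: F q u).

Section Fields.
Variables (W : set M) (oW : open W).

Lemma nabla_phi X Y q : smooth_vfield W X -> smooth_vfield W Y -> W q ->
  nabla X (fun r => F r (Y r)) q = F q (nabla X Y q) + dphi q (X q) (Y q).
Proof.
move=> sX sY Wq; case: hS => _ _ /(_ W X Y q oW sX sY Wq) E.
by rewrite /dphi -E addrC subrK.
Qed.

Lemma dfun_eta X Y q : smooth_vfield W X -> smooth_vfield W Y -> W q ->
  dfun (fun r => h r (Y r)) q (X q) =
  h q (nabla X Y q) + g q (Y q) (nabla X xi q).
Proof.
move=> sX sY Wq.
have -> : (fun r => h r (Y r)) = (fun r => g r (Y r) (xi r)).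
  by apply/funext => r; rewrite metric_xi.
by rewrite (nabla_metric hnabla oW sX sY (@xi_smooth_on W) Wq) metric_xi.
Qed.

(** The structure equation for Y = xi gives phi (nabla_X xi); since g(xi, xi)
    is constant, nabla_X xi is horizontal and phi can be inverted. *)
Lemma nabla_xi X q : smooth_vfield W X -> W q ->
  nabla X xi q = - al q *: F q (X q) - be q *: F q (F q (X q)).
Proof.
move=> sX Wq; have sxi := @xi_smooth_on W.
have h0 : h q (nabla X xi q) = 0.
  have := dfun_eta sX sxi Wq.
  have -> : (fun r => h r (xi r)) = (fun=> 1) by apply/funext => r; exact: eta_xi.
  by rewrite dfun_cst gC metric_xi; lra.
have := nabla_phi sX sxi Wq.
have -> : (fun r => F r (xi r)) = (fun=> 0) by apply/funext => r; exact: phi_xi.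
rewrite (nabla0r hnabla oW Wq sX) /dphi metric_xi F_xi bil0r scale0r add0r.
have -> : h q (xi q) = 1 by exact: h_xi.
rewrite !scale1r => E.
have Fn : F q (nabla X xi q) = - (al q *: F q (F q (X q)) + be q *: F q (X q)).
  apply/eqP; rewrite -addr_eq0 E FF; apply/eqP; congr (_ + (_ *: _ + _)).
  by rewrite addrC scaleNr.
have := FF q (nabla X xi q); rewrite h0 scale0r subr0 => <-.
by rewrite Fn mulNmx mulmxDl -!scalemxAl phi_phi_phi opprD scaleNr.
Qed.

Lemma dfunN f q v : smooth_fun W f -> W q ->
  dfun (fun r => - f r) q v = - dfun f q v.
Proof.
by move=> sf Wq; rewrite /dfun -deriveN//; exact/diff_derivable/(dfun_diff sf).
Qed.

Lemma smooth_funN f : smooth_fun W f -> smooth_fun W (fun r => - f r).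
Proof.
move=> sf; have E r : W r -> (-1 : R) * f r = - f r by rewrite mulN1r.
exact (smooth_fun_eq oW E (smooth_funM oW (@smooth_fun_cst _ _ M W (-1)) sf)).
Qed.

Let sN X Y : smooth_vfield W X -> smooth_vfield W Y ->
  smooth_vfield W (nabla X Y).
Proof. exact: (nabla_smooth hnabla oW). Qed.

Let sF X : smooth_vfield W X -> smooth_vfield W (fun r => F r (X r)).
Proof. exact: phi_smooth. Qed.

(** Differentiate - alpha phi V - beta phi^2 V along U. *)
Lemma nabla2_xi U V p : smooth_vfield W U -> smooth_vfield W V -> W p ->
  nabla U (nabla V xi) p =
  - dfun al p (U p) *: F p (V p)
  - al p *: (F p (nabla U V p) + dphi p (U p) (V p))
  + (- dfun be p (U p) *: F p (F p (V p))
     - be p *: (F p (F p (nabla U V p) + dphi p (U p) (V p))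
                + dphi p (U p) (F p (V p)))).
Proof.
move=> sU sV Wp; have sFV := sF sV; have sFFV := sF sFV.
have sa := smooth_funN (@al_smooth W); have sb := smooth_funN (@be_smooth W).
have s1 := smooth_vfieldZ oW sa sFV; have s2 := smooth_vfieldZ oW sb sFFV.
have E r : W r -> nabla V xi r =
    (- al r) *: F r (V r) + (- be r) *: F r (F r (V r)).
  by move=> Wr; rewrite (nabla_xi sV Wr) (scaleNr (be r)).
rewrite (nabla_eqr hnabla oW Wp sU (sN sV (@xi_smooth_on W)) E).
rewrite (nablaDr hnabla oW sU s1 s2 Wp).
rewrite (nablaZr hnabla oW sa sU sFV Wp) (nablaZr hnabla oW sb sU sFFV Wp).
rewrite (dfunN _ (@al_smooth W) Wp) (dfunN _ (@be_smooth W) Wp).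
rewrite (nabla_phi sU sFV Wp) (nabla_phi sU sV Wp).
by rewrite (scaleNr (al p)) (scaleNr (be p)).
Qed.

Lemma cov2_commutator_xi U V p : smooth_vfield W U -> smooth_vfield W V -> W p ->
  nabla U V p = nabla V U p ->
  cov2_commutator nabla U V xi p =
  xi_curvature_formula (phi S p) (eta_mx S p) (dfun al p) (dfun be p) (al p) (be p) (U p) (V p).
Proof.
move=> sU sV Wp UV; rewrite /cov2_commutator (nabla2_xi sU sV Wp) (nabla2_xi sV sU Wp) -UV.
rewrite /xi_curvature_formula -/(h p (U p)) -/(h p (V p)) /dphi !eta_phi0 !scale0r !addr0.
rewrite !mulmxDl -!scalemxAl !mulmxDl -!scalemxAl !F_xi !scaler0 !add0r !FF.
have e1 : g p (V p) (F p (U p)) = - g p (U p) (F p (V p)).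
  by rewrite gC metric_phi_skew.
have e2 : g p (V p) (U p) = g p (U p) (V p) by exact: gC.
have bNr (q : M) (u v : T) : g q u (- v) = - g q u v by exact: bilNr.
rewrite !bilDr !bNr !bilZr !metric_xi e1 e2.
move: (g p (U p) (V p)) (g p (U p) (F p (V p))) (nabla U V p) => s t N.
move: (dfun al p (U p)) (dfun al p (V p)) (dfun be p (U p)) (dfun be p (V p)).
move: (al p) (be p) (h p (U p)) (h p (V p)) => a b hU hV a1 a2 b1 b2.
move: (F p (U p)) (F p (V p)) (F p N) (h p N) (U p) (V p) (xi p) => u1 v1 N1 hN u v x.
by apply/rowP => j; rewrite !mxE; ring.
Qed.

End Fields.

Section AtPoint.
Variable p : M.
Local Notation Rm := (Riem nabla p).
Local Notation Rx := (xi_curvature_formula (phi S p) (eta_mx S p) (dfun al p) (dfun be p) (al p) (be p)).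
Local Notation W := (cdom (chart_at p)).
Let oW : open W. Proof. exact: open_cdom_at. Qed.
Let Wp : W p. Proof. exact: chart_at_dom. Qed.

Lemma Riem_xi u v : Rm u v (xi p) = Rx u v.
Proof.
have sC w := @const_field_smooth _ _ _ p w.
rewrite (Riem_field hnabla u v (@xi_smooth_on W)).
rewrite (cov2_commutator_xi oW (sC u) (sC v) Wp (nabla_const_sym hnabla u v Wp)).
by rewrite (const_field_id p u) (const_field_id p v).
Qed.

Let sal : smooth_fun W al := @al_smooth W.
Let sbe : smooth_fun W be := @be_smooth W.

Let aL c u w : dfun al p (c *: u + w) = c * dfun al p u + dfun al p w.
Proof. exact: (dfun_linear _ _ _ sal Wp). Qed.

Let bL c u w : dfun be p (c *: u + w) = c * dfun be p u + dfun be p w.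
Proof. exact: (dfun_linear _ _ _ sbe Wp). Qed.

Lemma dal_grad u : dfun al p u = g p (grad (metric S) al p) u.
Proof. by rewrite (sharp_bil hg). Qed.

Hypothesis hn : (1 <= n)%N.
Hypothesis hgrad : grad (metric S) al p *m phi S p =
  - (2 * n%:R - 1) *: grad (metric S) be p.

(** The gradient condition, paired with v. *)
Lemma dbe_phi v : (2 * n%:R - 1) * dfun be p v = dfun al p (F p v).
Proof.
have := congr1 (fun w => g p w v) hgrad.
rewrite metric_phi_skew -dal_grad bilZl (sharp_bil hg p v bL).
by rewrite mulNr => /oppr_inj.
Qed.

Let Rx_sym y w : g p (Rx (xi p) y) w = g p (Rx (xi p) w) y.
Proof.
by rewrite -(Riem_xi (xi p) y) -(Riem_xi (xi p) w); exact: (Riem_pair hg hnabla).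
Qed.

Let Rx_cyc u v w : g p (Rx u v) w + g p (Rx v w) u + g p (Rx w u) v = 0.
Proof.
have := bianchi_cyclic_sum (gD p) (gZ p) (Riem_skew34 hg hnabla p) (xi p) u v w
  (Riem_bianchi hnabla p).
by rewrite (Riem_xi u v) (Riem_xi v w) (Riem_xi w u).
Qed.

Lemma dal_xi : dfun al p (xi p) = 2 * al p * be p.
Proof.
exact: (dalpha_on_xi (gD p) (gZ p) (gC p) (@gnd p) (F_xi p) (h_F0 p) (h_xi p) (FF p)
  (g_F p) erefl hn aL dbe_phi Rx_sym).
Qed.

Lemma dbe_xi : dfun be p (xi p) = 0.
Proof. exact: (dbeta_on_xi (F_xi p) hn aL dbe_phi). Qed.

Lemma dal_phi0 x : (2 * n%:R - 2) * dfun al p (F p x) = 0.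
Proof.
exact: (dalpha_horizontal (gD p) (gZ p) (gC p) (@gnd p) (F_xi p) (h_F0 p) (h_xi p) (FF p)
  (g_F p) erefl aL dal_grad Rx_cyc).
Qed.

Lemma Riem_xiE u v :
  Rm u v (xi p) = - (al p ^+ 2 + be p ^+ 2) *: (h p v *: u - h p u *: v).
Proof.
rewrite Riem_xi.
exact: (xi_curvature_formulaE (gD p) (gZ p) (gC p) (@gnd p) (F_xi p) (h_F0 p) (h_xi p) (FF p)
  (g_F p) erefl hn aL bL dal_grad dbe_phi Rx_sym Rx_cyc
  (rank_phi_plus S p) (rank_phi_minus S p)).
Qed.

Let Rskew := Riem_skew34 hg hnabla p.
Let Rpair := Riem_pair hg hnabla p.
Let kap := al p ^+ 2 + be p ^+ 2.
Let c := (4 * kap - 4) / (2 * n%:R + 4).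

(** Every term that contains phi xi or g(xi, phi .) vanishes, the scalar
    curvature and Ric(Y, .) cancel, and the terms that remain are multiples of
    eta(Z) g(Y, w) - g(Y, Z) eta(w). *)
Lemma bochner4_xi (Y Z w : T) :
  bochner4 S nabla p (xi p) Y Z w = g p (c *: (h p Z *: Y - g p Y Z *: xi p)) w.
Proof.
have E1 : Riem4 (metric S) nabla p (xi p) Y Z w =
    kap * (h p Z * g p Y w - g p Y Z * h p w).
  exact: (nullity_xi_curvature (gD p) (gZ p) (gC p) Rpair Riem_xiE).
have E2 v : Ric nabla p (xi p) v = - (2 * n%:R) * kap * h p v.
  exact: (nullity_ric (gD p) (gZ p) (gC p) (@gnd p) (metric_xi p) erefl Rskew Rpair
    Riem_xiE).
have E3 v : Ric nabla p 0 v = 0.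
  exact: (curvature_ric0 (gD p) (gZ p) (gC p) (@gnd p) Rpair).
have gx v : g p (xi p) v = h p v by rewrite gC metric_xi.
have hx : h p (xi p) = 1 by exact: h_xi.
have n4 : 2 * n%:R + 4 != 0 :> R.
  by apply: lt0r_neq0; have : 0 <= n%:R :> R by []; lra.
have n2 : 2 * n%:R + 2 != 0 :> R.
  by apply: lt0r_neq0; have : 0 <= n%:R :> R by []; lra.
rewrite /bochner4 E1 F_xi !E2 !E3 !gx hx !eta_phi0 /c.
rewrite bilZl bilDl bilNl !bilZl gx.
move: (scal (metric S) nabla p) (Ric nabla p Y w) (Ric nabla p Y Z) => s r1 r2.
rewrite -/kap; move: kap (g p Y w) (g p Y Z) (h p Y) (h p Z) (h p w).
move: (Ric nabla p (F p Y) w) (Ric nabla p (F p Y) Z) (Ric nabla p (F p Z) w).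
move: (g p Y (F p w)) (g p Y (F p Z)) (g p Z (F p w)).
move: (n%:R : R) n4 n2 => N n4 n2 x1 x2 x3 x4 x5 x6 k y1 y2 y3 y4 y5.
by field; rewrite n4 n2.
Qed.

Lemma bochner_xi (Y Z : T) :
  bochner S nabla p (xi p) Y Z = c *: (h p Z *: Y - g p Y Z *: xi p).
Proof. by apply: (bil_sharp hg) => w; exact: bochner4_xi. Qed.

Lemma einstein_or_unit :
  (forall Y Z V : T,
    Ric nabla p (bochner S nabla p (xi p) Y Z) V
    + Ric nabla p Z (bochner S nabla p (xi p) Y V) = 0) ->
  kap = 1 \/ forall u v, Ric nabla p u v = - (2 * n%:R) * kap * g p u v.
Proof.
move=> hB; have hx : h p (xi p) = 1 by exact: h_xi.
have [c0|] := nullity_commuting_ric (gD p) (gZ p) (gC p) (@gnd p) (metric_xi p) hx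
  erefl Rskew Rpair Riem_xiE bochner_xi hB; last by right.
left; move/eqP: c0; rewrite mulf_eq0 invr_eq0 => /orP[/eqP|/eqP]; first lra.
by have : 0 <= n%:R :> R by []; lra.
Qed.

End AtPoint.

Hypothesis hn : (1 <= n)%N.
Hypothesis hgrad : forall p, grad (metric S) al p *m phi S p =
  - (2 * n%:R - 1) *: grad (metric S) be p.
Local Notation kappa := (fun q => al q ^+ 2 + be q ^+ 2).

(** * Constancy of alpha^2 + beta^2 *)
Section HorizontalDerivative.
Variable p : M.
Local Notation W := (cdom (chart_at p)).
Local Notation C := (const_field p).
Let oW : open W. Proof. exact: open_cdom_at. Qed.
Let Wp : W p. Proof. exact: chart_at_dom. Qed.
Let sal : smooth_fun W al := @al_smooth W.
Let sbe : smooth_fun W be := @be_smooth W.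
Let sxi : smooth_vfield W xi := @xi_smooth_on W.
Let sC u : smooth_vfield W (C u) := const_field_smooth u.

Let m_neq0 : 2 * n%:R - 1 != 0 :> R.
Proof.
have : (1 : R) <= n%:R by rewrite ler1n.
by move=> n1; apply: lt0r_neq0; lra.
Qed.

Lemma nabla_const_xi v : nabla (C v) xi p = - al p *: F p v - be p *: F p (F p v).
Proof. by rewrite (nabla_xi oW (sC v) Wp) const_field_id. Qed.

(** Differentiate (2n - 1) b(v) = a(phi v) along xi; the derivative of phi
    contributes nothing, since nabla_xi phi = 0. *)
Lemma hess_be_al v :
  (2 * n%:R - 1) * hess nabla p be (xi p) (C v) = hess nabla p al (xi p) (C (F p v)).
Proof.
have sFC : smooth_vfield W (fun r => F r (C v r)).
  exact (@phi_smooth _ _ _ S W _ oW (sC v)).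
have -> : C (F p v) = C ((fun r => F r (C v r)) p).
  by congr C; rewrite /= const_field_id.
rewrite -(hess_field hnabla (xi p) sal sFC) /hess.
have Cx : C (xi p) p = xi p by exact: const_field_id.
have -> : nabla (C (xi p)) (fun r => F r (C v r)) p = F p (nabla (C (xi p)) (C v) p).
  rewrite (nabla_phi oW (sC (xi p)) (sC v) Wp) Cx /dphi.
  rewrite (gC p (xi p)) metric_xi (gC p (xi p)) metric_xi eta_phi0 F_xi.
  by rewrite scaleNr addNr scale0r !(scaler0, add0r, addr0).
rewrite -(dbe_phi (hgrad p)) mulrBr; congr (_ - _).
have E r : W r -> dfun al r (F r (C v r)) = (2 * n%:R - 1) * dfun be r (C v r).
  by move=> _; rewrite (dbe_phi (hgrad r)).
rewrite (dfun_eq oW _ Wp E).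
rewrite (dfunM _ (@smooth_fun_cst _ _ M W (2 * n%:R - 1)) (smooth_dfun sbe (sC v)) Wp).
by rewrite dfun_cst mulr0 addr0.
Qed.

(** In [hess_be_al], exchange the arguments of both Hessians: they become
    derivatives of b(xi) = 0 and a(xi) = 2 alpha beta, corrected by
    nabla_v xi, and the corrections cancel. *)
Lemma al_be_horizontal v : al p * dfun be p (F p v) + be p * dfun al p (F p v) = 0.
Proof.
have hx f u : smooth_fun W f ->
    hess nabla p f (xi p) (C u) = dfun (fun q => dfun f q (xi q)) p u
    - dfun f p (nabla (C u) xi p).
  move=> sf; rewrite (hess_sym hnabla _ _ sf) -(hess_field hnabla u sf sxi).
  by rewrite /hess.
have := hess_be_al v; rewrite (hx _ _ sbe) (hx _ _ sal).
have -> : (fun q => dfun be q (xi q)) = (fun=> 0).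
  by apply/funext => q; exact: (dbe_xi hn (hgrad q)).
have -> : (fun q => dfun al q (xi q)) = (fun q => 2 * (al q * be q)).
  by apply/funext => q; rewrite (dal_xi hn (hgrad q)) mulrA.
rewrite dfun_cst !nabla_const_xi.
have sab := smooth_funM oW sal sbe.
rewrite (dfunM _ (@smooth_fun_cst _ _ M W 2) sab Wp) dfun_cst.
rewrite (dfunM _ sal sbe Wp) phi_phi_phi.
have L f (sf : smooth_fun W f) (a b : R) (x y : T) :
    dfun f p (- a *: x - b *: y) = - a * dfun f p x - b * dfun f p y.
  rewrite -(scaleNr b) (dfun_linear (- a) x _ sf Wp).
  by rewrite (dfunZr (- b) y sf Wp) (mulNr b).
rewrite (L _ sbe) (L _ sal).
have b1 := dbe_phi (hgrad p) (F p v).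
have b2 := dbe_phi (hgrad p) (F p (F p v)); rewrite phi_phi_phi in b2.
move: b1 b2; move: (dfun be p (F p v)) (dfun be p (F p (F p v))) => x y.
move: (dfun al p (F p v)) (dfun al p (F p (F p v))) => z t.
move: (2 * n%:R - 1 : R) (al p) (be p) => m a b e1 e2 e3.
have : (m * a * x + m * b * y) = 2 * (a * x + b * z) + a * t + b * z.
  move: e3; lra.
have -> : m * a * x = a * t by rewrite -e1; ring.
have -> : m * b * y = b * z by rewrite -e2; ring.
lra.
Qed.

Lemma kappa_smooth : smooth_fun W kappa.
Proof.
have E r : W r -> al r * al r + be r * be r = kappa r by rewrite !expr2.
exact (smooth_fun_eq oW E
  (smooth_funD oW (smooth_funM oW sal sal) (smooth_funM oW sbe sbe))).
Qed.

Lemma dkappaE v :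
  dfun kappa p v = 2 * (al p * dfun al p v + be p * dfun be p v).
Proof.
have -> : kappa = (fun q => al q * al q + be q * be q).
  by apply/funext => q; rewrite !expr2.
rewrite (dfunD _ (smooth_funM oW sal sal) (smooth_funM oW sbe sbe) Wp).
by rewrite (dfunM _ sal sal Wp) (dfunM _ sbe sbe Wp); ring.
Qed.

(** Multiplied by 2n - 1, half of the derivative is
    (2n - 1) alpha a(phi v) + beta a(phi^2 v), while [al_be_horizontal] for
    phi v gives alpha a(phi v) + (2n - 1) beta a(phi^2 v) = 0.  The two differ
    by multiples of (2n - 2) a, which vanishes on horizontal vectors. *)
Lemma dkappa_phi v : dfun kappa p (F p v) = 0.
Proof.
rewrite dkappaE.
have := al_be_horizontal (F p v).
have := dal_phi0 p v; have := dal_phi0 p (F p v).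
have := dbe_phi (hgrad p) (F p v).
have := dbe_phi (hgrad p) (F p (F p v)); rewrite phi_phi_phi.
move: (dfun be p (F p v)) (dfun be p (F p (F p v))) => x y.
move: (dfun al p (F p v)) (dfun al p (F p (F p v))) => z t.
move: (n%:R : R) m_neq0 (al p) (be p) => N m0 a b e1 e2 e3 e4 e5.
apply: (mulfI m0); rewrite mulr0.
have {e1} E1 : (2 * N - 1) * (a * y) = a * z by rewrite -e1; ring.
have {e2} E2 : (2 * N - 1) * (b * x) = b * t by rewrite -e2; ring.
have E3 : (2 * N - 1) * (b * t) = b * t.
  by transitivity (b * t + b * ((2 * N - 2) * t)); [ring|rewrite e3 mulr0 addr0].
have E4 : (2 * N - 1) * (a * z) = a * z.
  by transitivity (a * z + a * ((2 * N - 2) * z)); [ring|rewrite e4 mulr0 addr0].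
have E5 : (2 * N - 1) * (a * y + b * t) = 0 by rewrite e5 mulr0.
lra.
Qed.

Lemma dkappa_eta v : dfun kappa p v = 4 * (al p * al p * be p) * h p v.
Proof.
have {1}-> : v = h p v *: xi p + F p (F p v) by rewrite FF addrC subrK.
rewrite (dfun_linear _ _ _ kappa_smooth Wp) dkappa_phi dkappaE.
by rewrite (dal_xi hn (hgrad p)) (dbe_xi hn (hgrad p)); ring.
Qed.

End HorizontalDerivative.

Section DerivativeOfKappa.
Variable p : M.
Local Notation W := (cdom (chart_at p)).
Local Notation C := (const_field p).
Let oW : open W. Proof. exact: open_cdom_at. Qed.
Let Wp : W p. Proof. exact: chart_at_dom. Qed.
Let sC u : smooth_vfield W (C u) := const_field_smooth u.
Local Notation e := (fun q => 4 * (al q * al q * be q)).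

Let se : smooth_fun W e.
Proof.
have s4 := @smooth_fun_cst _ _ M W 4.
have sa := @al_smooth W; have sb := @be_smooth W.
exact: (smooth_funM oW s4 (smooth_funM oW (smooth_funM oW sa sa) sb)).
Qed.

Lemma hess_kappa u v :
  hess nabla p kappa u (C v) =
  dfun e p u * h p v + e p * g p v (- al p *: F p u - be p *: F p (F p u)).
Proof.
have E r : W r -> dfun kappa r (C v r) = e r * h r (C v r).
  by move=> _; exact: dkappa_eta.
have Cu : C u p = u by exact: const_field_id.
have Cv : C v p = v by exact: const_field_id.
have sh : smooth_fun W (fun r => h r (C v r)).
  exact (@eta_smooth _ _ _ S W _ oW (sC v)).
rewrite /hess (dfun_eq oW _ Wp E) (dfunM _ se sh Wp).
have Eh := dfun_eta oW (sC u) (sC v) Wp.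
rewrite Cu Cv nabla_const_xi in Eh; rewrite Eh Cv dkappa_eta.
by ring.
Qed.

(** The antisymmetric part of [hess_kappa] on horizontal vectors is a nonzero
    multiple of alpha^3 beta g(u, phi v). *)
Lemma dkappa0 v : dfun kappa p v = 0.
Proof.
have d1 : (1 < (2 * n).+1)%N by rewrite ltnS muln_gt0.
have [y [w yw]] := paracontact_phi_neq0 (gZ p) (@gnd p) (h_xi p) (FF p) d1.
have := hess_sym hnabla (F p y) (F p w) (@kappa_smooth p).
rewrite !hess_kappa !eta_phi0 !phi_phi_phi !mulr0 !add0r.
have bN u x : g p u (- x) = - g p u x by exact: bilNr.
have G1 : g p (F p w) (F p (F p y)) = - g p (F p y) w.
  by rewrite g_F eta_phi0 mulr0 addr0 gC.
have G2 : g p (F p y) (F p (F p w)) = g p (F p y) w.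
  by rewrite g_F eta_phi0 mulr0 addr0 metric_phi_skew.
have G3 : g p (F p w) (F p y) = g p (F p y) (F p w) by exact: gC.
rewrite !bilDr !bN !bilZr G1 G2 G3 dkappa_eta.
move: (g p (F p y) w) yw (g p (F p y) (F p w)) (al p) (be p) (h p v).
move=> q q0 s a b t E.
have {E} : 8 * (a * a * b) * a * q = 0 by move: E; lra.
move/eqP; rewrite mulf_eq0 (negbTE q0) orbF mulf_eq0 => /orP[|/eqP ->]; last lra.
by rewrite mulf_eq0 pnatr_eq0 /= => /eqP ->; rewrite mulr0 mul0r.
Qed.

End DerivativeOfKappa.

Lemma kappa_near p : \forall q \near p, kappa q = kappa p.
Proof.
have ac : atlas (chart_at p) by exact: chart_at_atlas.
have op : open (cdom (chart_at p)) by exact: open_cdom_at.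
have cp : cdom (chart_at p) p by exact: chart_at_dom.
pose U := cmap (chart_at p) @` cdom (chart_at p).
have oU : open U by exact: (chart_image_open ac op).
have Ux : U (cmap (chart_at p) p) by exists p.
have sk := @kappa_smooth p.
have dk y : U y -> differentiable (kappa \o cinv (chart_at p)) y.
  by move=> [q cq <-]; exact: (smooth_fun_differentiable sk cq ac cq).
have Dk y v : U y -> 'D_v (kappa \o cinv (chart_at p)) y = 0.
  move=> [q cq <-]; have E := dfun_const_field v sk cq cq.
  by rewrite dkappa0 in E; exact: esym E.
have near_cst := derive0_near_cst oU Ux dk Dk.
have [_ _ _ cc _] := atlas_is_chart ac.
rewrite (continuous_open_subspace _ op) in cc.
have {}near_cst := cc p (mem_set cp) _ near_cst.
apply: filterS2 (open_nbhs_nbhs (conj op cp)) near_cst => q cq /=.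
by rewrite (chartK ac cq) (chartK ac cp).
Qed.

(** The level sets are open, by [kappa_near], so each of them is closed too. *)
Lemma kappa_cst : connected [set: M] -> forall p q, kappa p = kappa q.
Proof.
move=> cM p q; suff : [set r | kappa r = kappa q] = setT.
  by move=> E; have : [set: M] p by []; rewrite -E.
apply: cM.
- by exists q.
- exists [set r | kappa r = kappa q]; last by rewrite setTI.
  rewrite openE => r /= rq; rewrite /interior.
  by apply: filterS (kappa_near r) => r' /= ->.
- exists [set r | kappa r = kappa q]; last by rewrite setTI.
  rewrite -[X in closed X]setCK; apply: open_closedC.
  rewrite openE => r /= rq; rewrite /interior.
  by apply: filterS (kappa_near r) => r' /= ->.
Qed.

End TransParaSasakianGeometry.

(** * The dichotomy *)

Theorem theorem3p15 (R : realType) (n : nat) (hn : (1 <= n)%N)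
    (M : smoothManifold R (2 * n).+1) (hM : connected [set: M])
    (S : paracontact M) (nabla : vfield M -> vfield M -> vfield M)
    (hnabla : levi_civita (metric S) nabla)
    (alpha beta : M -> R)
    (hS : trans_para_sasakian S nabla alpha beta)
    (hgrad : forall p : M,
      grad (metric S) alpha p *m phi S p =
        - (2 * n%:R - 1) *: grad (metric S) beta p)
    (hB : forall (p : M) (Y Z V : 'rV[R]_((2 * n).+1)),
      Ric nabla p (bochner S nabla p (xi S p) Y Z) V
      + Ric nabla p Z (bochner S nabla p (xi S p) Y V) = 0) :
  (einstein (metric S) nabla
   /\ forall p : M,
        scal (metric S) nabla p =
          - (2 * n%:R * (2 * n%:R + 1) * (alpha p ^+ 2 + beta p ^+ 2)))
  \/ (forall p : M, alpha p ^+ 2 + beta p ^+ 2 = 1).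
Proof.
have [[q q1]|none] := pselect (exists q, alpha q ^+ 2 + beta q ^+ 2 = 1).
  by right=> p; rewrite -q1; exact: (kappa_cst hnabla hS hn hgrad hM).
left.
have ricE p u v : Ric nabla p u v =
    - (2 * n%:R) * (alpha p ^+ 2 + beta p ^+ 2) * bil (metric S) p u v.
  have [p1|] := einstein_or_unit hnabla hS hn (hgrad p) (hB p); last exact.
  by case: none; exists p.
split; first by exists (fun p => - (2 * n%:R) * (alpha p ^+ 2 + beta p ^+ 2)).
move=> p; rewrite /scal.
have -> : \matrix_(i, j) Ric nabla p (unit_vec i) (unit_vec j) =
    (- (2 * n%:R) * (alpha p ^+ 2 + beta p ^+ 2)) *: metric S p.
  apply/matrixP => i j; rewrite !mxE ricE /bil /unit_vec.
  by rewrite -rowE trmx_delta -colE !mxE.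
have [_ gU _] := metric_pseudo_riemannian S.
rewrite -scalemxAr mulVmx// mxtraceZ mxtrace1.
by rewrite -[(2 * n).+1]addn1 natrD natrM; ring.
Qed.
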